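(* Let $d=2$ and let $\{X_t\}_{t\ge 0}$ be the two-dimensional critical super-Brownian motion with binary branching mechanism $\psi(u)=u^2$. Let $\mathbb{P}$ denote its law when started from a Poisson random measure on $\mathbb{R}^2$ whose intensity is the Lebesgue measure $\lambda$, and let $\mathbb{P}_\lambda$ denote its law when started from $X_0=\lambda$. Let $R_t:=\sup\{u>0: X_t(B(u))=0\}$, where $B(u)=\{x\in\mathbb{R}^2:|x|<u\}$ and $\sup\emptyset=0$. Then for any $r\in(0,\infty)$, $$\lim_{t\to\infty}\mathbb{P}\left(\frac{R_t}{\sqrt t}\geq r\right)=e^{-A_2(r)}\in(0,1),$$ where $A_2(r):=-\log\mathbb{P}_{\lambda}(X_1(B(r))=0)$ satisfies $$\lim_{r\to\infty}\frac{A_2(r)}{\pi r^2}=1.$$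
   Context: Fix a constant $p>d$ and let $\phi_p(x):=(1+|x|^2)^{-p/2}$ for $x\in\mathbb{R}^d$. Let $M_p$ be the space of locally finite measures $\mu$ on $\mathbb{R}^d$ with $\int_{\mathbb{R}^d}\phi_p(x)\,\mu(dx)<\infty$, with the topology in which $\mu_n\to\mu$ iff $\int f\,d\mu_n\to\int f\,d\mu$ for all $f\in\{g+\alpha\phi_p:\alpha\in\mathbb{R},\ g\in C_c(\mathbb{R}^d)\}$. The $d$-dimensional super-Brownian motion with branching mechanism $\psi(u)=u^2$ and initial value $X_0=\mu\in M_p$ (law $\mathbb{P}_\mu$, expectation $\mathbb{E}_\mu$) is the $M_p$-valued Markov process $\{X_t\}_{t\ge0}$ whose transition probabilities are characterized by $$\mathbb{E}_\mu\left[e^{-\langle X_t,\phi\rangle}\right]=e^{-\int_{\mathbb{R}^d}u(t,x)\,\mu(dx)},\qquad \langle X_t,\phi\rangle:=\int_{\mathbb{R}^d}\phi(x)\,X_t(dx),$$ for every nonnegative continuous $\phi$ with $\sup_x \phi(x)/\phi_p(x)<\infty$, where $u$ is the unique positive solution of $$\frac{\partial u(t,x)}{\partial t}=\frac12\Delta u(t,x)-u^2(t,x),\qquad u(0,x)=\phi(x).$$ $\mathrm{PRM}(\lambda)$ is the Poisson random measure on $\mathbb{R}^d$ with intensity the Lebesgue measure $\lambda$, and $\mathbb{P}:=\mathbb{P}_{\mathrm{PRM}(\lambda)}$ is the law of the super-Brownian motion when $X_0$ is distributed as $\mathrm{PRM}(\lambda)$ (so that, given $X_0=\mu$, the process has law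 $\mathbb{P}_\mu$). *)

(* Defs.v *)
From HB Require Import structures.
From mathcomp Require Import all_boot all_order all_algebra.
From mathcomp Require Import all_classical all_reals all_analysis.
From mathcomp Require Import measurable_realfun.

Set Implicit Arguments.
Unset Strict Implicit.
Unset Printing Implicit Defensive.

Import Order.TTheory GRing.Theory Num.Theory.
Import numFieldNormedType.Exports.

Local Open Scope classical_set_scope.
Local Open Scope ring_scope.

(* R^2 with its Borel sigma-algebra. [lebesgue_measure] lives on
   [measurableTypeR R], an alias of R, hence so do all measures below; functions
   and sets are written on R * R, which is convertible to [plane R] and carries
   the topological and normed structures. *)
Notation plane R := (measurableTypeR R * measurableTypeR R)%type.

Section tempered_measures.
Context {R : realType}.

(* The norm that the library puts on R * R is the max norm. *)
Definition enorm (x : R * R) : R := Num.sqrt (x.1 ^+ 2 + x.2 ^+ 2).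

Definition disc (u : R) : set (R * R) := [set x | enorm x < u].

Definition leb2 : {measure set (plane R) -> \bar R} :=
  (lebesgue_measure \x lebesgue_measure)%E.

Definition phi_ (p : R) (x : R * R) : R := (1 + enorm x ^+ 2) `^ (- p / 2).

Definition locally_finite (mu : {measure set (plane R) -> \bar R}) : Prop :=
  forall K : set (R * R), compact K -> (mu K < +oo)%E.

Definition test_function (p : R) (f : R * R -> R) : Prop :=
  exists g alpha, [/\ continuous g, compact (closure [set x | g x != 0]) &
    forall x, f x = g x + alpha * phi_ p x].

(* A measure of the library is a function on all sets, measurable or not; the
   topology and sigma-algebra given to [Mp p] below only see its values on
   Borel sets. *)
Record Mp (p : R) := MkMp {
  Mp_measure :> {measure set (plane R) -> \bar R} ;
  Mp_locally_finite : locally_finite Mp_measure ;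
  Mp_tempered : (\int[Mp_measure]_x (phi_ p x)%:E < +oo)%E }.

Fact mzero_locally_finite : locally_finite (@mzero _ (plane R) R).
Proof. by move=> K _; exact: ltry. Qed.

Fact mzero_tempered (p : R) :
  (\int[@mzero _ (plane R) R]_x (phi_ p x)%:E < +oo)%E.
Proof. by rewrite integral_measure_zero; exact: ltry. Qed.

HB.instance Definition _ (p : R) := gen_eqMixin (Mp p).
HB.instance Definition _ (p : R) := gen_choiceMixin (Mp p).
HB.instance Definition _ (p : R) :=
  isPointed.Build (Mp p) (MkMp mzero_locally_finite (mzero_tempered p)).

Definition Mp_eval (p : R) (mu : Mp p) :
    {ptws {f | test_function p f} -> R} :=
  fun f => \int[mu]_x (proj1_sig f x).

(* The coarsest topology for which mu |-> \int f dmu is continuous for every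
   test function f, so that mu_n --> mu iff all these integrals converge. *)
HB.instance Definition _ (p : R) :=
  Topological.copy (Mp p) (initial_topology (@Mp_eval p)).

Definition Mp_borel (p : R) : set (set (Mp p)) := <<s (@open (Mp p)) >>.

Definition Mp_display : measure_display.
Proof. by constructor. Qed.

HB.instance Definition _ (p : R) :=
  @isMeasurable.Build Mp_display (Mp p) (@Mp_borel p)
    (@sigma_algebra0 _ setT _) (@sigma_algebraC (Mp p) _)
    (@sigma_algebra_bigcup _ setT _).

End tempered_measures.

Section super_brownian_motion.
Context {R : realType}.

Definition laplacian (f : R * R -> R) (x : R * R) : R :=
  'D_((1, 0) : R * R) ('D_((1, 0) : R * R) f) x +
  'D_((0, 1) : R * R) ('D_((0, 1) : R * R) f) x.

(* u is C^{1,2} on (0, +oo) x R^2; spatial derivatives are taken along all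
   vectors v and w, which includes the mixed partial derivatives. *)
Definition C12 (u : R -> R * R -> R) : Prop :=
  let D := [set z : R * (R * R) | 0 < z.1] in
  [/\ forall t x, 0 < t -> derivable (u ^~ x) t 1,
      forall v t x, 0 < t -> derivable (u t) x v,
      forall v w t x, 0 < t -> derivable ('D_v (u t)) x w,
      {within D, continuous (fun z => 'D_1 (u ^~ z.2) z.1)} &
      forall v w, {within D, continuous (fun z => 'D_v (u z.1) z.2)} /\
        {within D, continuous (fun z => 'D_w ('D_v (u z.1)) z.2)}].

(* "Positive" means nonnegative: the solution is 0 when phi is. *)
Definition positive_solution (phi : R * R -> R) (u : R -> R * R -> R) : Prop :=
  [/\ forall t x, 0 <= t -> 0 <= u t x,
      {within [set z : R * (R * R) | 0 <= z.1],
        continuous (fun z => u z.1 z.2)},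
      C12 u,
      forall t x, 0 < t ->
        'D_1 (u ^~ x) t = 2^-1 * laplacian (u t) x - u t x ^+ 2 &
      forall x, u 0 x = phi x].

Definition unique_positive_solution (phi : R * R -> R)
    (u : R -> R * R -> R) : Prop :=
  positive_solution phi u /\
  forall v, positive_solution phi v -> forall t x, 0 <= t -> v t x = u t x.

Definition admissible (p : R) (phi : R * R -> R) : Prop :=
  [/\ continuous phi, forall x, 0 <= phi x &
    has_ubound (range (fun x => phi x / phi_ p x))].

(* Only the kernels Q t with 0 <= t matter. *)
Definition sbm_transition (p : R) (Q : R -> R.-pker (Mp p) ~> (Mp p)) : Prop :=
  forall phi, admissible p phi ->
  exists u, unique_positive_solution phi u /\
    forall t (mu : Mp p), 0 <= t ->
      (\int[Q t mu]_nu expeR (- \int[(nu : Mp p)]_x (phi x)%:E) =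
       expeR (- \int[mu]_x (u t x)%:E))%E.

Context {d : measure_display} {Omega : measurableType d}.
Variable P : probability Omega R.

Definition history (p : R) (X : R -> Omega -> Mp p) (s : R) :
    set (set Omega) :=
  <<s \bigcup_(r in `[0, s]) preimage_set_system setT (X r) measurable >>.

Definition markov_process (p : R) (Q : R -> R.-pker (Mp p) ~> (Mp p))
    (X : R -> Omega -> Mp p) : Prop :=
  (forall t, 0 <= t -> measurable_fun setT (X t)) /\
  forall s t G (A : set (Mp p)), 0 <= s -> 0 <= t ->
    history X s G -> measurable A ->
    P (G `&` X (s + t) @^-1` A) = (\int[P]_(w in G) Q t (X s w) A)%E.

Definition super_brownian_motion (p : R) (X : R -> Omega -> Mp p) : Prop :=
  exists Q, sbm_transition Q /\ markov_process Q X.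

Definition poisson_random_measure (Lambda : {measure set (plane R) -> \bar R})
    (p : R) (N : Omega -> Mp p) : Prop :=
  [/\ forall B m, measurable B -> Lambda B = m%:E -> forall k : nat,
        P [set w | N w B = k%:R%:E] = (m ^+ k / k`!%:R * expR (- m))%:E,
      forall B, measurable B -> Lambda B = +oo%E ->
        P [set w | N w B = +oo%E] = 1%E &
      forall n (B : 'I_n -> set (plane R)) (A : 'I_n -> set (\bar R)),
        (forall i, measurable (B i)) -> trivIset setT B ->
        (forall i, measurable (A i)) ->
        P (\bigcap_i [set w | A i (N w (B i))]) =
        (\prod_(i < n) P [set w | A i (N w (B i))])%E].

Definition starts_from (p : R) (X : R -> Omega -> Mp p)
    (mu : {measure set (plane R) -> \bar R}) : Prop :=
  {ae P, forall w B, measurable B -> X 0 w B = mu B}.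

(* R_t = hole_radius (X_t); the maximum with 0 implements sup {} = 0. *)
Definition hole_radius (mu : {measure set (plane R) -> \bar R}) : \bar R :=
  maxe 0%E (ereal_sup [set u%:E | u in [set u | 0 < u /\ mu (disc u) = 0%E]]).

(* ln 0 = 0 in the library: a vanishing probability would give A2 = 0. *)
Definition A2 (p : R) (Y : R -> Omega -> Mp p) (r : R) : R :=
  - ln (fine (P [set w | Y 1 w (disc r) = 0%E])).

End super_brownian_motion.

(* Main.v *)
(* The probability that X_t(B(v)) = 0 is the limit as n grows of the
   Laplace functional of n (v - |x|)^+.  Write u_n for the solution started from
   n (r - |x|)^+.  Brownian scaling u(t, x) -> c^2 u(c^2 t, c x) reduces time t and
   radius r sqrt t to time 1 and radius r, so that starting from Lebesgue measure
   the probability is exp(-A), A = lim int u_n(1, x) dx, while starting from a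
   Poisson random measure u_n(1, .) is replaced by t (1 - exp(-u_n(1, .) / t)); as
   u_n(1, .) <= 1 the two exponents differ by a factor at most 1 + 1/t.
   Explicit super- and subsolutions of the equation, compared with u by the
   maximum principle on balls, show that u_n(1, x) <= 1, that
   u_n(1, x) <= 800 / (|x| - r)^4 outside B(r), and that lim u_n(1, x) >= exp(-4 / L^2)
   on B(r - L).  Integrating gives 0 < A < oo and A ~ pi r^2. *)
Require Import Defs.
From HB Require Import structures.
From mathcomp Require Import all_boot all_order all_algebra.
From mathcomp Require Import all_classical all_reals all_analysis.
From mathcomp Require Import ring lra measurable_realfun.
From mathcomp Require finmap.

Set Implicit Arguments.
Unset Strict Implicit.
Unset Printing Implicit Defensive.

Import Order.TTheory GRing.Theory Num.Theory.
Import numFieldNormedType.Exports.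

Local Open Scope classical_set_scope.
Local Open Scope ring_scope.

(** * Second derivatives along lines, and the second-derivative test at a maximum *)

Section second_derivative.
Context {R : realType}.
Implicit Types (f g : R -> R).

(** Solutions are known only through [positive_solution]: they are regular, but carry no growth
    condition at infinity, so no global comparison is at hand. Comparison is therefore local. The
    supersolution is infinite on a sphere and thus dominates any continuous function near it, while
    its value at the centre depends on the radius alone. A radius tending to infinity gives the
    bound 1; the largest ball avoiding the support of the datum gives the fourth-power decay, which
    is integrable in the plane and makes A finite.

    Monotonicity in n is not proved from the equation: it is read off the Laplace functionals of the
    process started from point masses.

    For the Poisson start both inequalities between the exponents hold for each n with a factor
    depending on t only. Hence n tends to infinity at fixed t, t tends to infinity afterwards, and
    no exchange of limits occurs. The Laplace functional of the Poisson random measure is derived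
    from the law and the independence of its counts on the level sets of a simple function. *)

Definition has_second_derivative f (x a : R) : Prop :=
  exists f' : R -> R, (\forall s \near x, is_derive s (1 : R) f (f' s)) /\
    is_derive x (1 : R) f' a.

Lemma is_derive_line (V : normedModType R) (F : V -> R) (x v : V) (s : R) :
  derivable F (x + s *: v) v ->
  is_derive s (1 : R) (fun r => F (x + r *: v)) ('D_v F (x + s *: v)).
Proof.
move=> dF.
have E : (fun h : R => h^-1 *: (((fun r => F (x + r *: v)) \o shift s) (h *: 1) -
    F (x + s *: v))) = (fun h : R => h^-1 *: ((F \o shift (x + s *: v)) (h *: v) -
    F (x + s *: v))).
  apply/funext => h /=.
  by rewrite [h *: 1]mulr1 scalerDl addrCA.
split; first by rewrite /derivable /= E.
by rewrite /derive /= E.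
Qed.

Lemma has_second_derivative_line (V : normedModType R) (F : V -> R) (x v : V) :
  (forall y, derivable F y v) -> derivable ('D_v F) x v ->
  has_second_derivative (fun r => F (x + r *: v)) 0 ('D_v ('D_v F) x).
Proof.
move=> dF ddF; exists (fun r => 'D_v F (x + r *: v)); split.
  by near=> s; apply: is_derive_line.
have {1}-> : x = x + 0 *: v by rewrite scale0r addr0.
have := @is_derive_line V ('D_v F) x v 0.
by rewrite scale0r addr0; apply.
Unshelve. all: by end_near. Qed.

Lemma has_second_derivativeD f g x a b :
  has_second_derivative f x a -> has_second_derivative g x b ->
  has_second_derivative (fun s => f s + g s) x (a + b).
Proof.
move=> [f' [nf df]] [g' [ng dg]]; exists (fun s => f' s + g' s); split.
  near=> s.
  by apply: is_deriveD; [near: s|near: s].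
exact: is_deriveD.
Unshelve. all: by end_near. Qed.

Lemma has_second_derivativeZ f (c : R) x a :
  has_second_derivative f x a ->
  has_second_derivative (fun s => c * f s) x (c * a).
Proof.
move=> [f' [nf df]]; exists (fun s => c * f' s); split.
  near=> s.
  by apply: (@is_deriveZ _ _ _ f c s 1); near: s.
exact: (@is_deriveZ _ _ _ f' c x 1).
Unshelve. all: by end_near. Qed.

Lemma has_second_derivative_cst (c : R) x :
  has_second_derivative (fun=> c) x 0.
Proof.
exists (fun=> 0); split; last exact: is_derive_cst.
by near=> s; exact: is_derive_cst.
Unshelve. all: by end_near. Qed.

(** If [a] were positive, [f'], which vanishes at the maximum, would be positive just to the right
    of [x], and the mean value theorem would produce a larger value of [f] there. *)
Lemma second_derivative_max f x a :
  (\forall s \near x, f s <= f x) -> has_second_derivative f x a -> a <= 0.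
Proof.
move=> fmax [f' [df df']]; rewrite leNgt; apply/negP => a0.
have [e e0 He] : exists2 e : R, 0 < e &
    forall s, `|s - x| < e -> f s <= f x /\ is_derive s 1 f (f' s).
  have : \forall s \near x, f s <= f x /\ is_derive s 1 f (f' s).
    by near=> s; split; near: s.
  move=> /nbhs_ballP[e /= e0 H]; exists e => // s sx; apply: H.
  by rewrite /ball /= distrC.
have fx0 : f' x = 0.
  have xI : x \in `](x - e), (x + e)[.
    by rewrite in_itv /= ltrBlDr ltrDl e0.
  have H : is_derive x 1 f 0.
    apply: (@derive1_at_max _ f (x - e) (x + e) x) => //.
    + by lra.
    + move=> t; rewrite in_itv /= => /andP[t1 t2].
      have [|_ ?] := He t; last by [].
      by rewrite ltr_norml; apply/andP; split; lra.
    + move=> t; rewrite in_itv /= => /andP[t1 t2].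
      have [|//] := He t.
      by rewrite ltr_norml; apply/andP; split; lra.
  have [|_ H2] := He x; first by rewrite subrr normr0.
  by rewrite -(@derive_val _ _ _ _ _ _ _ H2) (@derive_val _ _ _ _ _ _ _ H).
have : (fun h : R => h^-1 *: (f' (h + x) - f' x)) @ 0^' --> a.
  have := @derivable_nbhs _ _ _ f' x 1.
  case: df' => + <-.
  rewrite /derivable /derive /= => H _.
  under eq_fun => h do rewrite -[X in f' (X + x)](mulr1 h).
  exact: H.
move=> /cvgrPdist_lt /(_ _ a0); move=> /nbhs_ballP[d /= d0 Hd].
pose h := Num.min d e / 2.
have m0 : 0 < Num.min d e by rewrite lt_min d0.
have h0 : 0 < h by rewrite divr_gt0.
have hd : h < d.
  rewrite (lt_le_trans (y := Num.min d e)) ?ge_min ?lexx// /h.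
  by rewrite ltr_pdivrMr// ltr_pMr// ltr1n.
have he : h < e.
  rewrite (lt_le_trans (y := Num.min d e)) ?ge_min ?lexx ?orbT// /h.
  by rewrite ltr_pdivrMr// ltr_pMr// ltr1n.
have pos s : 0 < s -> s < d -> 0 < f' (s + x).
  move=> s0 sd.
  have := Hd s; rewrite /ball /= sub0r normrN (gtr0_norm s0) => /(_ sd).
  rewrite fx0 subr0 => /(_ (lt0r_neq0 s0)).
  rewrite ltr_norml => /andP[_]; rewrite ltrBlDl -ltrBlDr subrr.
  by rewrite /GRing.scale /= pmulr_rgt0// invr_gt0.
have [c] : exists2 c, c \in `]x, (x + h)[ & f (x + h) - f x = f' c * (x + h - x).
  apply: MVT; first by rewrite ltrDl.
    move=> t; rewrite in_itv /= => /andP[t1 t2]; have [|//] := He t.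
    by rewrite ltr_norml; apply/andP; split; lra.
  apply: derivable_within_continuous => t.
  rewrite in_itv /= => /andP[t1 t2]; have [|_ []//] := He t.
  by rewrite ltr_norml; apply/andP; split; lra.
rewrite in_itv /= => /andP[c1 c2] E.
have [|fh _] := He (x + h).
  by rewrite addrC addKr gtr0_norm.
have := pos (c - x); rewrite subrK => Hp.
have : 0 < f' c * (x + h - x).
  by apply: mulr_gt0; [apply: Hp|]; lra.
by rewrite -E subr_gt0 ltNge fh.
Unshelve. all: by end_near. Qed.

End second_derivative.

(** * Maximum principle on space-time cylinders over Euclidean balls *)

Section comparison.
Context {R : realType}.
Implicit Types (w : R -> R * R -> R).

(** The square is kept because it is a quadratic polynomial along every line, so that barriers
    depending on it can be differentiated explicitly. *)
Definition sqdist (x y : R * R) : R := (x.1 - y.1) ^+ 2 + (x.2 - y.2) ^+ 2.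

Definition cball (x : R * R) (k : R) : set (R * R) := [set y | sqdist y x <= k].

Lemma continuous_sqdist (x : R * R) : continuous (sqdist ^~ x).
Proof.
move=> y; rewrite /sqdist; under eq_fun do rewrite !expr2.
apply: cvgD; apply: cvgM; apply: cvgB; by
  [exact: cvg_cst|exact: cvg_fst|exact: cvg_snd].
Qed.

Lemma compact_cball x k : compact (cball x k).
Proof.
have [k0|k0] := ltP k 0.
  suff -> : cball x k = set0 by exact: compact0.
  rewrite -subset0 => y; rewrite /cball /= => H.
  have : 0 <= sqdist y x by rewrite addr_ge0// sqr_ge0.
  lra.
pose s := k + 1.
apply: (@subclosed_compact _ _ (`[x.1 - s, x.1 + s] `*` `[x.2 - s, x.2 + s])).
- rewrite (_ : cball x k = (sqdist ^~ x) @^-1` [set r | r <= k])//.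
  by apply: closed_comp; [move=> y _; exact: continuous_sqdist|exact: closed_le].
- by apply: compact_setX; exact: segment_compact.
- move=> y; rewrite /cball /sqdist /= => H.
  have aux (a b : R) : a ^+ 2 + b ^+ 2 <= k -> - (k + 1) <= a <= k + 1.
    move=> ab; have b2 := sqr_ge0 b.
    by rewrite -ler_norml -ler_sqr ?nnegrE ?real_normK ?num_real//; nra.
  have /andP[? ?] := aux _ _ H; rewrite addrC in H; have /andP[? ?] := aux _ _ H.
  by rewrite !in_itv /= /s; split; apply/andP; split; lra.
Qed.

(* At a positive maximum of [w t y - eps * t] the time derivative of [w] is at
   least [eps] while its second derivatives are nonpositive. *)
Lemma max_principle w (x0 : R * R) (k : R) :
  {within `[0, 1] `*` cball x0 k, continuous (fun z => w z.1 z.2)} ->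
  (forall x, sqdist x x0 <= k -> w 0 x <= 0) ->
  (forall t x, 0 <= t <= 1 -> sqdist x x0 = k -> w t x <= 0) ->
  (forall t x, 0 < t <= 1 -> sqdist x x0 < k -> 0 < w t x ->
    exists dt a b, [/\ is_derive t (1 : R) (w ^~ x) dt,
      has_second_derivative (fun s => w t (x + s *: ((1, 0) : R * R))) 0 a,
      has_second_derivative (fun s => w t (x + s *: ((0, 1) : R * R))) 0 b &
      dt <= 2^-1 * (a + b)]) ->
  forall t x, 0 <= t <= 1 -> sqdist x x0 <= k -> w t x <= 0.
Proof.
move=> cw w0 wb wp t x t01 xk; rewrite leNgt; apply/negP => wtx.
(* As [t <= 1], the value [w t x - e * t] is still positive, so the maximum taken below is at a
   point where [w] is positive. *)
pose e := w t x / 2.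
have e0 : 0 < e by rewrite divr_gt0.
have cK : compact (`[0, 1] `*` cball x0 k : set (R * (R * R))).
  by apply: compact_setX; [exact: segment_compact|exact: compact_cball].
have cf : {within `[0, 1] `*` cball x0 k,
    continuous (fun z : R * (R * R) => w z.1 z.2 - e * z.1)}.
  move=> z; apply: cvgB; first exact: cw.
  apply: cvgM; first exact: cvg_cst.
  by apply: (@continuous_subspaceT _ _ _ fst) => y; exact: cvg_fst.
have [|[s y] /= sy smax] := compact_EVT_max _ cK cf.
  by exists (t, x); split => //=; rewrite in_itv.
have /= := smax (t, x); rewrite inE /= in_itv /= => /(_ (conj t01 xk)) le1.
move: sy; rewrite inE /= in_itv /= => -[s01 yk].
have wsy : 0 < w s y.
  have : 0 < w t x - e * t by rewrite /e; nra.
  have : 0 <= e * s by rewrite mulr_ge0// ?(ltW e0)//; case/andP: s01.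
  move=> ? ?; lra.
have s0 : 0 < s.
  rewrite lt0r; case/andP: s01 => -> _; rewrite andbT.
  by apply: contraTN wsy => /eqP ->; rewrite -leNgt w0.
have yk' : sqdist y x0 < k.
  rewrite lt_neqAle yk andbT.
  by apply: contraTN wsy => /eqP sk; rewrite -leNgt wb.
have s1 : s <= 1 by case/andP: s01.
have [|dt [a [b [ddt da db le2]]]] := wp s y _ yk' wsy; first by rewrite s0.
have H v c : has_second_derivative (fun r => w s (y + r *: (v : R * R))) 0 c -> c <= 0.
  apply: second_derivative_max; rewrite scale0r addr0.
  have : \forall r \near (0 : R), sqdist (y + r *: v) x0 < k.
    have : sqdist (y + r *: v) x0 @[r --> (0 : R)] --> sqdist (y + 0 *: v) x0.
      apply: (@continuous_comp _ _ _ (fun r : R => y + r *: v) (sqdist ^~ x0)).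
        by apply: cvgD; [exact: cvg_cst|exact: scalel_continuous].
      exact: continuous_sqdist.
    by rewrite scale0r addr0 => /cvgr_lt /(_ k); apply.
  apply: filterS => r /ltW rk.
  have := smax (s, y + r *: v); rewrite inE /= in_itv /= => /(_ (conj s01 rk)).
  by rewrite lerD2r.
have a0 := H _ _ da.
have b0 := H _ _ db.
suff : e <= dt by lra.
(* The maximum may lie at [s = 1], where only earlier times belong to the cylinder; quotients with
   [h < 0] still converge to [dt]. *)
have : (fun h : R => h^-1 * (w (h + s) y - w s y)) @ 0^'- --> dt.
  case: ddt => + <-; rewrite /derivable /derive => ddt.
  apply: cvg_dnbhs_at_left.
  under eq_fun => h do rewrite -[X in w (X + s)](mulr1 h).
  exact: ddt.
move=> /cvgr_to_ge; apply.
near=> h.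
have h0 : h < 0 by near: h; exact: nbhs_left_lt.
have hs : - s < h by near: h; apply: nbhs_left_gt; rewrite oppr_lt0.
have := smax (h + s, y); rewrite inE /= in_itv /= => le3'.
have {le3'}/le3' le3 : 0 <= h + s <= 1 /\ cball x0 k y.
  by split => //; apply/andP; split; lra.
rewrite mulrC ler_ndivlMr //; nra.
Unshelve. all: by end_near. Qed.

End comparison.

(** * Derivatives of the barrier profiles *)

Section barriers.
Context {R : realType}.

Lemma solution_derivatives (phi : R * R -> R) u (t : R) (x : R * R) :
  positive_solution phi u -> 0 < t ->
  exists a b : R, [/\
    is_derive t (1 : R) (u ^~ x) (2^-1 * (a + b) - u t x ^+ 2),
    has_second_derivative (fun s => u t (x + s *: ((1, 0) : R * R))) 0 a &
    has_second_derivative (fun s => u t (x + s *: ((0, 1) : R * R))) 0 b].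
Proof.
case=> _ _ [dt dx ddx _ _] pde _ t0.
exists ('D_((1, 0) : R * R) ('D_((1, 0) : R * R) (u t)) x),
  ('D_((0, 1) : R * R) ('D_((0, 1) : R * R) (u t)) x); split.
- by rewrite -/(laplacian (u t) x) -(pde t x t0); apply: derivableP; exact: dt.
- apply: has_second_derivative_line; first by move=> y; exact: dx.
  exact: ddx.
- apply: has_second_derivative_line; first by move=> y; exact: dx.
  exact: ddx.
Qed.

Lemma solution_continuous_within (phi : R * R -> R) u (K : set (R * R)) :
  positive_solution phi u ->
  {within `[0, 1] `*` K, continuous (fun z => u z.1 z.2)}.
Proof.
case=> _ cu _ _ _; apply: continuous_subspaceW cu => z /= [].
by rewrite in_itv /= => /andP[].
Qed.

Lemma is_derive1_eq (f : R -> R) (x d d' : R) :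
  is_derive x (1 : R) f d -> d = d' -> is_derive x (1 : R) f d'.
Proof. by move=> ? <-. Qed.

(** The spatial profile of the supersolution: along a coordinate line through [x] the squared
    distance to the centre grows by [2 a s + s^2], and [Q] stands for [K - |x - x0|^2]. *)
Lemma has_second_derivative_invX4 (Q a : R) : 0 < Q ->
  has_second_derivative (fun s => ((Q - (2 * a * s + s ^+ 2))^-1) ^+ 4) 0
    (80 * a ^+ 2 * (Q^-1) ^+ 6 + 8 * (Q^-1) ^+ 5).
Proof.
move=> Q0.
have dq s : is_derive s (1 : R) (fun s : R => Q - (2 * a * s + s ^+ 2)) (- (2 * a + 2 * s)).
  by apply: is_derive_eq; rewrite /GRing.scale /=; ring.
have di s : Q - (2 * a * s + s ^+ 2) != 0 ->
    is_derive s (1 : R) (fun s : R => (Q - (2 * a * s + s ^+ 2))^-1)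
      ((2 * a + 2 * s) * (Q - (2 * a * s + s ^+ 2))^-1 ^+ 2).
  move=> q0; refine (is_derive1_eq (@is_deriveV _ _ s _ _ q0 (dq s)) _).
  by rewrite /GRing.scale /=; field.
exists (fun s => 8 * (a + s) * (Q - (2 * a * s + s ^+ 2))^-1 ^+ 5); split.
  have : \forall s \near (0 : R), Q - (2 * a * s + s ^+ 2) != 0.
    have : (Q - (2 * a * s + s ^+ 2)) @[s --> (0 : R)] --> Q - (2 * a * 0 + 0 ^+ 2).
      have /derivable1_diffP/differentiable_continuous := ex_derive (is_derive := dq 0).
      exact.
    by move=> /cvgr_neq0; apply; rewrite mulr0 expr2 mulr0 addr0 subr0 gt_eqF.
  apply: filterS => s q0.
  have D := di _ q0.
  refine (is_derive1_eq (is_deriveX 4 D) _).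
  by rewrite /GRing.scale /=; ring.
have q0 : Q - (2 * a * 0 + 0 ^+ 2) != 0.
  by rewrite mulr0 expr2 mulr0 addr0 subr0 gt_eqF.
have D := di _ q0.
have D8 : is_derive (0 : R) (1 : R) (fun s : R => 8 * (a + s)) 8.
  by apply: is_derive_eq; rewrite /GRing.scale /=; ring.
refine (is_derive1_eq (is_deriveM D8 (is_deriveX 5 D)) _).
rewrite /GRing.scale /= exprfctE !mulr0 expr2 !mulr0 !addr0 !subr0; ring.
Qed.

(** The spatial profile of the subsolution, with [k = 1 / K] and [Q = 1 - |x - x0|^2 / K]. *)
Lemma has_second_derivative_sqr (Q a k : R) :
  has_second_derivative (fun s => (Q - (2 * a * s + s ^+ 2) * k) ^+ 2) 0
    (8 * a ^+ 2 * k ^+ 2 - 4 * Q * k).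
Proof.
have dq s : is_derive s (1 : R) (fun s : R => Q - (2 * a * s + s ^+ 2) * k)
    (- (2 * a + 2 * s) * k).
  by apply: is_derive_eq; rewrite /GRing.scale /=; ring.
exists (fun s => 2 * (Q - (2 * a * s + s ^+ 2) * k) * (- (2 * a + 2 * s) * k)); split.
  near=> s; refine (is_derive1_eq (is_deriveX 2 (dq s)) _).
  by rewrite /GRing.scale /=; ring.
have D0 := dq 0.
apply: is_derive_eq; rewrite /GRing.scale /=; ring.
Unshelve. all: by end_near. Qed.

(** [c / (1 + c t)] is the spatially constant solution, [y' = - y^2] with [y 0 = c]; at time 1 it is
    below 1 however large [c] is. *)
Lemma is_derive_logistic (c t : R) : 0 <= c -> 0 <= t ->
  is_derive t (1 : R) (fun t => c / (1 + c * t)) (- (c / (1 + c * t)) ^+ 2).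
Proof.
move=> c0 t0.
have q0 : 1 + c * t != 0 by rewrite gt_eqF// ltr_wpDr// mulr_ge0.
have D : is_derive t (1 : R) (fun t => 1 + c * t) c.
  by apply: is_derive_eq; rewrite /GRing.scale /=; ring.
refine (is_derive1_eq (is_deriveZ c (@is_deriveV _ _ t _ _ q0 D)) _).
by rewrite /GRing.scale /=; field.
Qed.

End barriers.

(** * Upper and lower bounds for a solution at time 1 by comparison with barriers *)

Section solution_bounds.
Context {R : realType}.

Lemma sqdist_line1 (x x0 : R * R) (s : R) :
  sqdist (x + s *: ((1, 0) : R * R)) x0 =
  sqdist x x0 + (2 * (x.1 - x0.1) * s + s ^+ 2).
Proof. rewrite /sqdist /= /GRing.scale /=; ring. Qed.

Lemma sqdist_line2 (x x0 : R * R) (s : R) :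
  sqdist (x + s *: ((0, 1) : R * R)) x0 =
  sqdist x x0 + (2 * (x.2 - x0.2) * s + s ^+ 2).
Proof. rewrite /sqdist /= /GRing.scale /=; ring. Qed.

Lemma sqdist_ge0 (x y : R * R) : 0 <= sqdist x y.
Proof. by rewrite addr_ge0// sqr_ge0. Qed.

Lemma sqdistxx (x : R * R) : sqdist x x = 0.
Proof. by rewrite /sqdist !subrr expr0n /= addr0. Qed.

(* Comparison with [c / (1 + c t) + 400 (1 + t) K^2 / (K - |x - x0|^2)^4], a
   supersolution that blows up on the boundary of the ball, so that no a priori
   bound on [u] is needed. *)
Lemma solution_upper_bound (phi : R * R -> R) u x0 (K c : R) :
  positive_solution phi u -> 0 < K -> 0 <= c ->
  (forall x, sqdist x x0 <= K -> phi x <= c) ->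
  u 1 x0 <= c / (1 + c) + 800 / K ^+ 2.
Proof.
move=> su K0 c0 phic.
(* [M] depends on [u], but it only decides how close to the sphere the comparison takes place; it is
   absent from the final bound. *)
have [M M0 uM] : exists2 M : R, 0 < M & forall t x, 0 <= t <= 1 ->
    sqdist x x0 <= K -> u t x <= M.
  have cK : compact (`[0, 1] `*` cball x0 K : set (R * (R * R))).
    by apply: compact_setX; [exact: segment_compact|exact: compact_cball].
  have cu := @solution_continuous_within _ _ _ (cball x0 K) su.
  have [|z /= zK zM] := compact_EVT_max _ cK cu.
    exists (0, x0); split; rewrite /= ?in_itv /= ?lexx ?ler01//.
    by rewrite /cball /= sqdistxx ltW.
  exists (`|u z.1 z.2| + 1); first by rewrite ltr_wpDl.
  move=> t x t01 xK; have := zM (t, x); rewrite inE /= in_itv /=.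
  move=> /(_ (conj t01 xK)); have := ler_norm (u z.1 z.2); lra.
have K2 : 0 < K ^+ 2 by exact: exprn_gt0.
have [C CE] : exists C, C = 400 * K ^+ 2 by eexists.
have C0 : 0 < C by rewrite CE; lra.
(* On the sphere [sqdist x x0 = K - e] the barrier is at least [C / e^4 >= M], because
   [e^4 <= e <= C / M]. *)
pose e := Num.min (Num.min 1 K) (C / M).
have e0 : 0 < e by rewrite !lt_min ltr01 K0 /=; exact: divr_gt0.
have e1 : e <= 1 by rewrite !ge_min lexx.
have eK : e <= K by rewrite !ge_min lexx !orbT.
have eM : M <= C * e^-1 ^+ 4.
  rewrite exprVn ler_pdivlMr ?exprn_gt0//.
  have : e <= C / M by rewrite !ge_min lexx !orbT.
  rewrite ler_pdivlMr// => H.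
  apply: le_trans H; rewrite mulrC ler_wpM2r// ?(ltW M0)//.
  rewrite -[leRHS]mulr1 exprS ler_wpM2l ?(ltW e0)//.
  by rewrite exprn_ile1// ltW.
pose v t x := c / (1 + c * t) + C * (1 + t) * (K - sqdist x x0)^-1 ^+ 4.
pose w t x := u t x - v t x.
suff : w 1 x0 <= 0.
  rewrite /w /v sqdistxx subr0 mulr1 subr_le0 => /le_trans; apply.
  rewrite lerD2l CE exprVn le_eqVlt; apply/orP; left; apply/eqP; field.
  by rewrite gt_eqF.
have pos x : sqdist x x0 <= K - e -> 0 < K - sqdist x x0 by lra.
apply: (@max_principle _ w x0 (K - e)); last 2 first.
- by rewrite ler01 lexx.
- by rewrite sqdistxx subr_ge0.
- have cu := @solution_continuous_within _ _ _ (cball x0 (K - e)) su.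
  suff cv : {within `[0, 1] `*` cball x0 (K - e), continuous (fun z => v z.1 z.2)}.
    by move=> z; apply: cvgB; [exact: cu|exact: cv].
  apply: continuous_in_subspaceT => -[t x]; rewrite inE /= in_itv /=.
  move=> [/andP[t0 t1] xK].
  apply: cvgD.
    apply: cvgM; first exact: cvg_cst.
    apply: cvgV; first by rewrite gt_eqF// ltr_wpDr// mulr_ge0.
    apply: cvgD; first exact: cvg_cst.
    by apply: cvgM; [exact: cvg_cst|exact: cvg_fst].
  apply: cvgM.
    apply: cvgM; first exact: cvg_cst.
    by apply: cvgD; [exact: cvg_cst|exact: cvg_fst].
  have CV : (K - sqdist z.2 x0)^-1 @[z --> (t, x)] --> (K - sqdist x x0)^-1.
    apply: cvgV; first by rewrite gt_eqF// pos.
    apply: cvgB; first exact: cvg_cst.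
    apply: (@cvg_comp _ _ _ snd (sqdist ^~ x0)); first exact: cvg_snd.
    exact: continuous_sqdist.
  exact: (cvg_comp _ _ CV (@exprn_continuous _ 4 _)).
- move=> x xK; rewrite /w /v; have [_ _ _ _ ->] := su.
  rewrite mulr0 addr0 divr1 mulr1 subr_le0.
  have xK' : sqdist x x0 <= K by lra.
  rewrite (le_trans (phic _ xK'))// lerDl mulr_ge0//.
    exact: ltW.
  by rewrite exprn_ge0// invr_ge0 ltW// pos.
- move=> t x t01 xK; rewrite /w /v xK subKr subr_le0.
  have xK' : sqdist x x0 <= K by lra.
  apply: le_trans (uM _ _ t01 xK') _; apply: le_trans eM _.
  have /andP[t0 t1] := t01.
  have H0 : 0 <= C * e^-1 ^+ 4.
    by rewrite mulr_ge0 ?(ltW C0)// exprn_ge0// invr_ge0 ltW.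
  have H1 : 0 <= c / (1 + c * t).
    by rewrite divr_ge0// addr_ge0// mulr_ge0.
  nra.
move=> t x /andP[t0 t1] xK wtx.
have [a [b [dt da db]]] := solution_derivatives x su t0.
set q := K - sqdist x x0.
have q0 : 0 < q by rewrite /q; lra.
have db1 := has_second_derivative_invX4 (x.1 - x0.1) q0.
have db2 := has_second_derivative_invX4 (x.2 - x0.2) q0.
set z := q^-1.
set bt := c / (1 + c * t).
exists (2^-1 * (a + b) - u t x ^+ 2 - (- bt ^+ 2 + C * z ^+ 4)).
exists (a + - (C * (1 + t)) * (80 * (x.1 - x0.1) ^+ 2 * z ^+ 6 + 8 * z ^+ 5)).
exists (b + - (C * (1 + t)) * (80 * (x.2 - x0.2) ^+ 2 * z ^+ 6 + 8 * z ^+ 5)).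
split.
- have D1 := is_derive_logistic c0 (ltW t0).
  have D2 : is_derive t (1 : R) (fun t => C * (1 + t) * z ^+ 4) (C * z ^+ 4).
    by apply: is_derive_eq; rewrite /GRing.scale /=; ring.
  exact: (is_deriveB dt (is_deriveD D1 D2)).
- have := has_second_derivativeD da (has_second_derivativeD
    (has_second_derivative_cst (- bt) 0) (has_second_derivativeZ (- (C * (1 + t))) db1)).
  rewrite add0r; congr has_second_derivative; apply/funext => s.
  rewrite /w /v sqdist_line1 (opprD (sqdist x x0)) (addrA K) -/q -/bt; ring.
- have := has_second_derivativeD db (has_second_derivativeD
    (has_second_derivative_cst (- bt) 0) (has_second_derivativeZ (- (C * (1 + t))) db2)).
  rewrite add0r; congr has_second_derivative; apply/funext => s.
  rewrite /w /v sqdist_line2 (opprD (sqdist x x0)) (addrA K) -/q -/bt; ring.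
have bt0 : 0 <= bt by rewrite divr_ge0// addr_ge0// mulr_ge0// ltW.
set B := C * (1 + t) * z ^+ 4.
have z0 : 0 < z by rewrite invr_gt0.
have B0 : 0 <= B.
  rewrite /B mulr_ge0 ?exprn_ge0 ?(ltW z0)// mulr_ge0 ?addr_ge0 ?(ltW t0) ?(ltW C0)//.
(* The differential inequality is required only where [u > v], hence [u^2 >= (bt + B)^2]. The cross
   term is dropped: [bt^2] pays for the logistic part and [B^2] for the Laplacian of the singular
   part. *)
have uB : bt ^+ 2 + B ^+ 2 <= u t x ^+ 2.
  have : bt + B <= u t x by move: wtx; rewrite /w /v subr_gt0 => /ltW.
  move=> H; nra.
(* The constant 400 makes the difference a perfect square; [C z^4] is the time derivative
   contributed by the factor [1 + t]. At [t = 1] in the centre, [C (1 + t) / K^4] is the [800 / K^2]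
   of the conclusion. *)
have key : (1 + t) * C * (40 * K * z ^+ 6) <= B ^+ 2 + C * z ^+ 4.
  rewrite -subr_ge0.
  rewrite (_ : _ - _ = C * z ^+ 4 * (20 * ((1 + t) * K * z ^+ 2) - 1) ^+ 2); last first.
    rewrite /B CE; ring.
  rewrite mulr_ge0 ?sqr_ge0// mulr_ge0 ?exprn_ge0 ?(ltW z0) ?(ltW C0)//.
have zq1 : z * q = 1 by rewrite mulVf ?gt_eqF.
have zq : z ^+ 5 = z ^+ 6 * q by rewrite (exprSr z 5) -mulrA zq1 mulr1.
(* With [|x - x0|^2 = K - q], the coefficient [80 |x - x0|^2 + 16 q] is at most [80 K]. *)
have key2 : 80 * (x.1 - x0.1) ^+ 2 * z ^+ 6 + 8 * z ^+ 5 +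
    (80 * (x.2 - x0.2) ^+ 2 * z ^+ 6 + 8 * z ^+ 5) <= 80 * K * z ^+ 6.
  rewrite (_ : _ + _ = (80 * sqdist x x0 + 16 * q) * z ^+ 6); last first.
    rewrite zq /sqdist; ring.
  rewrite ler_wpM2r ?exprn_ge0 ?(ltW z0)//.
  rewrite /q; have := sqdist_ge0 x x0; lra.
have tC0 : 0 <= (1 + t) * C by rewrite mulr_ge0 ?addr_ge0 ?(ltW t0) ?(ltW C0).
have key3 := ler_wpM2l tC0 key2.
lra.
Qed.

(* [c exp(-4t/K) / (1 + c t) (1 - |x - x0|^2 / K)^2] is a subsolution. *)
Lemma solution_lower_bound (phi : R * R -> R) u x0 (K c : R) :
  positive_solution phi u -> 0 < K -> 0 <= c ->
  (forall x, sqdist x x0 <= K -> c <= phi x) ->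
  expR (- (4 / K)) * (c / (1 + c)) <= u 1 x0.
Proof.
move=> su K0 c0 phic.
pose a t := expR (- (4 / K) * t) * (c / (1 + c * t)).
pose v t x := a t * (1 - sqdist x x0 * K^-1) ^+ 2.
pose w t x := v t x - u t x.
suff : w 1 x0 <= 0.
  rewrite /w /v /a sqdistxx mul0r subr0 expr1n !mulr1 subr_le0 => /le_trans; exact.
apply: (@max_principle _ w x0 K); last 2 first.
- by rewrite ler01 lexx.
- by rewrite sqdistxx ltW.
- have cu := @solution_continuous_within _ _ _ (cball x0 K) su.
  suff cv : {within `[0, 1] `*` cball x0 K, continuous (fun z => v z.1 z.2)}.
    by move=> z; apply: cvgB; [exact: cv|exact: cu].
  apply: continuous_in_subspaceT => -[t x]; rewrite inE /= in_itv /=.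
  move=> [/andP[t0 t1] xK].
  apply: cvgM.
    apply: cvgM.
      apply: continuous_comp; last exact: continuous_expR.
      by apply: cvgM; [exact: cvg_cst|exact: cvg_fst].
    apply: cvgM; first exact: cvg_cst.
    apply: cvgV; first by rewrite gt_eqF// ltr_wpDr// mulr_ge0.
    apply: cvgD; first exact: cvg_cst.
    by apply: cvgM; [exact: cvg_cst|exact: cvg_fst].
  have CV : (1 - sqdist z.2 x0 * K^-1) @[z --> (t, x)] --> 1 - sqdist x x0 * K^-1.
    apply: cvgB; first exact: cvg_cst.
    apply: cvgM; last exact: cvg_cst.
    apply: (@cvg_comp _ _ _ snd (sqdist ^~ x0)); first exact: cvg_snd.
    exact: continuous_sqdist.
  exact: (cvg_comp _ _ CV (@exprn_continuous _ 2 _)).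
- move=> x xK; rewrite /w /v /a; have [_ _ _ _ ->] := su.
  rewrite !mulr0 expR0 addr0 divr1 mul1r subr_le0.
  apply: le_trans (phic _ xK); rewrite -[leRHS]mulr1 ler_wpM2l//.
  have K1 : 0 <= sqdist x x0 * K^-1 by rewrite mulr_ge0 ?sqdist_ge0 ?invr_ge0 ?ltW.
  have K2 : sqdist x x0 * K^-1 <= 1 by rewrite ler_pdivrMr// mul1r.
  nra.
- move=> t x /andP[t0 t1] xK; rewrite /w /v xK divff ?gt_eqF// subrr expr0n /= mulr0.
  by rewrite sub0r oppr_le0; have [-> ] := su.
move=> t x /andP[t0 t1] xK wtx.
have [d1 [d2 [dt da db]]] := solution_derivatives x su t0.
set q := 1 - sqdist x x0 * K^-1.
have db1 := has_second_derivative_sqr q (x.1 - x0.1) K^-1.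
have db2 := has_second_derivative_sqr q (x.2 - x0.2) K^-1.
set L := 4 / K.
set bt := c / (1 + c * t).
exists ((- L * a t - expR (- L * t) * bt ^+ 2) * q ^+ 2 + - (2^-1 * (d1 + d2) - u t x ^+ 2)).
exists (a t * (8 * (x.1 - x0.1) ^+ 2 * K^-1 ^+ 2 - 4 * q * K^-1) + (- 1) * d1).
exists (a t * (8 * (x.2 - x0.2) ^+ 2 * K^-1 ^+ 2 - 4 * q * K^-1) + (- 1) * d2).
split.
- have D1 := is_derive_logistic c0 (ltW t0).
  have D2 : is_derive t (1 : R) (fun t => expR (- L * t)) (- L * expR (- L * t)).
    by apply: is_derive_eq; rewrite /GRing.scale /=; ring.
  have D3 := is_deriveM D2 D1.
  have D4 := is_deriveZ (q ^+ 2) D3.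
  have D5 := is_deriveB D4 dt.
  have -> : w ^~ x = (q ^+ 2 \*: ((fun t => expR (- L * t)) *
    (fun t => c / (1 + c * t)))) - u ^~ x.
    by apply/funext => s; rewrite /w /v /a -/q mulrC.
  refine (is_derive1_eq D5 _).
  rewrite /GRing.scale /= -/bt /a -/bt -/L; ring.
- have := has_second_derivativeD (has_second_derivativeZ (a t) db1)
    (has_second_derivativeZ (-1) da).
  congr has_second_derivative; apply/funext => s.
  rewrite /w /v sqdist_line1 (mulrDl (sqdist x x0)) (opprD (sqdist x x0 * _)) (addrA 1) -/q; ring.
- have := has_second_derivativeD (has_second_derivativeZ (a t) db2)
    (has_second_derivativeZ (-1) db).
  congr has_second_derivative; apply/funext => s.
  rewrite /w /v sqdist_line2 (mulrDl (sqdist x x0)) (opprD (sqdist x x0 * _)) (addrA 1) -/q; ring.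
have Ki0 : 0 < K^-1 by rewrite invr_gt0.
have L0 : 0 < L by rewrite divr_gt0.
have bt0 : 0 <= bt by rewrite divr_ge0// addr_ge0// mulr_ge0// ltW.
have at0 : 0 <= a t by rewrite mulr_ge0// expR_ge0.
have ut0 : 0 <= u t x by have [-> //] := su; exact: ltW.
have q0 : 0 <= q by rewrite subr_ge0 ler_pdivrMr// mul1r ltW.
have q1 : q <= 1 by rewrite gerBl mulr_ge0 ?sqdist_ge0// ltW.
(* [a t = exp(- L t) bt], and squaring leaves a spare factor [exp(- L t) <= 1]; so the nonlinear
   loss built into [a] dominates [u^2] wherever [u < v]. *)
have abt : (a t) ^+ 2 <= expR (- L * t) * bt ^+ 2.
  rewrite /a -/L -/bt exprMn ler_wpM2r ?sqr_ge0// expr2.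
  rewrite -[leRHS]mulr1 ler_wpM2l ?expR_ge0//.
  by rewrite -expR0 ler_expR mulNr oppr_le0 mulr_ge0// ltW.
have uv : u t x ^+ 2 <= (a t * q ^+ 2) ^+ 2.
  have : u t x <= a t * q ^+ 2 by move: wtx; rewrite /w /v -/q subr_gt0 => /ltW.
  move=> H; rewrite ler_sqr ?nnegrE//.
  by rewrite mulr_ge0 ?sqr_ge0.
have E : 2^-1 * (a t * (8 * (x.1 - x0.1) ^+ 2 * K^-1 ^+ 2 - 4 * q * K^-1) + (- 1) * d1 +
   (a t * (8 * (x.2 - x0.2) ^+ 2 * K^-1 ^+ 2 - 4 * q * K^-1) + (- 1) * d2)) =
   L * a t * (1 - 2 * q) - 2^-1 * (d1 + d2).
  have qE : sqdist x x0 * K^-1 = 1 - q by rewrite /q; ring.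
  transitivity (a t * (4 * (sqdist x x0 * K^-1) * K^-1 - 4 * q * K^-1) - 2^-1 * (d1 + d2)).
    by rewrite /sqdist; field; rewrite gt_eqF.
  rewrite qE /L; ring.
rewrite E.
have q20 : 0 <= q ^+ 2 by exact: sqr_ge0.
have H1 := ler_wpM2r q20 abt.
(* The origin of the rate [4 / K]: with it the decay [- L a q^2] and the half Laplacian
   [L a (1 - 2 q)] differ by [L a (1 - q)^2]. *)
have H2 : 0 <= L * a t * (1 - q) ^+ 2.
  by rewrite mulr_ge0 ?sqr_ge0// mulr_ge0// ltW.
have H3 : 0 <= (a t) ^+ 2 * (q ^+ 2 * (1 - q ^+ 2)).
  have q21 : 0 <= 1 - q ^+ 2 by rewrite subr_ge0 exprn_ile1.
  by rewrite mulr_ge0 ?sqr_ge0// mulr_ge0.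
rewrite exprMn in uv.
nra.
Qed.

End solution_bounds.

(** * Parabolic scaling of solutions *)

Section scaling.
Context {R : realType}.

Lemma within_continuous_compl (T U : topologicalType) (A : set T) (S : T -> T)
    (f : T -> U) :
  continuous S -> (forall z, A z -> A (S z)) ->
  {within A, continuous f} -> {within A, continuous (fun z => f (S z))}.
Proof.
move=> cS AS /subspace_continuousP cf; apply/subspace_continuousP => z Az.
have H := cf _ (AS _ Az).
move=> B /H /=; rewrite /nbhs /= /within /= => HB.
have := cS z _ HB; rewrite /nbhs /=; apply: filterS => y /= HBy Ay.
exact/HBy/AS.
Qed.

Lemma cvg_dnbhs_scale (c : R) : 0 < c -> c * h @[h --> 0^'] --> 0^'.
Proof.
move=> c0 A [e /= e0 HA]; exists (e / c); first by rewrite /= divr_gt0.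
move=> h; rewrite /ball /= sub0r normrN => he h0; apply: HA.
  by rewrite /ball /= sub0r normrN normrM (gtr0_norm c0) mulrC -ltr_pdivlMr.
by rewrite mulf_neq0// gt_eqF.
Qed.

Lemma is_derive_scale (V : normedModType R) (F : V -> R) (k c : R) (x v : V) :
  0 < c -> derivable F (c *: x) v ->
  is_derive x v (fun y => k * F (c *: y)) (k * c * 'D_v F (c *: x)).
Proof.
move=> c0 dF.
have H : (fun h : R => h^-1 *: (((fun y => k * F (c *: y)) \o shift x) (h *: v) -
    (fun y => k * F (c *: y)) x)) @ 0^' --> k * c * 'D_v F (c *: x).
  have H : (fun h : R => (c * h)^-1 *: (F ((c * h) *: v + c *: x) - F (c *: x))) @ 0^'
      --> 'D_v F (c *: x) by exact: cvg_comp (cvg_dnbhs_scale c0) dF.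
  have H2 : (fun h : R => k * c * ((c * h)^-1 *: (F ((c * h) *: v + c *: x) - F (c *: x)))) @ 0^'
      --> k * c * 'D_v F (c *: x) by apply: cvgM; [exact: cvg_cst|exact: H].
  apply: cvg_trans H2; apply: near_eq_cvg; near=> h.
  have h0 : h != 0 by near: h; exact: nbhs_dnbhs_neq.
  rewrite /= (scalerDr c) scalerA -mulrBr /GRing.scale /=.
  by field; rewrite h0 gt_eqF.
split; first by apply/cvg_ex; eexists; exact: H.
exact: (cvg_lim _ H).
Unshelve. all: by end_near. Qed.

(** The time derivative, the Laplacian and the square each acquire the factor [c^4]. Only the
    property of being a solution is transported; uniqueness for the scaled datum is invoked later,
    in [cone_solution_scale]. *)
Lemma positive_solution_scale (phi : R * R -> R) u (c : R) :
  positive_solution phi u -> 0 < c ->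
  positive_solution (fun x => c ^+ 2 * phi (c *: x))
    (fun t x => c ^+ 2 * u (c ^+ 2 * t) (c *: x)).
Proof.
move=> [u0 cu [dt dx ddx cdt cdx] pde ui] c0.
have c20 : 0 < c ^+ 2 by exact: exprn_gt0.
pose S (z : R * (R * R)) : R * (R * R) := (c ^+ 2 * z.1, c *: z.2).
have cS : continuous S.
  move=> z.
  have C1 : c ^+ 2 * y.1 @[y --> z] --> c ^+ 2 * z.1.
    by apply: cvgM; [exact: cvg_cst|exact: cvg_fst].
  have C2 : c *: y.2 @[y --> z] --> c *: z.2.
    by apply: (@cvg_comp _ _ _ snd (fun y : R * R => c *: y));
      [exact: cvg_snd|exact: scaler_continuous].
  exact: (cvg_pair C1 C2).
have dtE (t : R) (x : R * R) : 0 < t -> is_derive t (1 : R) (fun t => c ^+ 2 * u (c ^+ 2 * t) (c *: x))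
    (c ^+ 2 * c ^+ 2 * 'D_1 (u ^~ (c *: x)) (c ^+ 2 * t)).
  move=> t0; apply: (@is_derive_scale R (u ^~ (c *: x))) => //.
  by apply: dt; exact: mulr_gt0.
have dxE (v : R * R) (t : R) (x : R * R) : 0 < t -> is_derive x v (fun x => c ^+ 2 * u (c ^+ 2 * t) (c *: x))
    (c ^+ 2 * c * 'D_v (u (c ^+ 2 * t)) (c *: x)).
  move=> t0; apply: (@is_derive_scale _ (u (c ^+ 2 * t))) => //.
  by apply: dx; exact: mulr_gt0.
have DxE (v : R * R) (t : R) : 0 < t -> 'D_v (fun x => c ^+ 2 * u (c ^+ 2 * t) (c *: x)) =
    fun x => c ^+ 2 * c * 'D_v (u (c ^+ 2 * t)) (c *: x).
  by move=> t0; apply/funext => x; apply: derive_val; exact: dxE.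
have ddxE (v w : R * R) (t : R) (x : R * R) : 0 < t ->
    is_derive x w ('D_v (fun x => c ^+ 2 * u (c ^+ 2 * t) (c *: x)))
    (c ^+ 2 * c * c * 'D_w ('D_v (u (c ^+ 2 * t))) (c *: x)).
  move=> t0; rewrite DxE//; apply: (@is_derive_scale _ ('D_v (u (c ^+ 2 * t)))) => //.
  by apply: ddx; exact: mulr_gt0.
have SD (z : R * (R * R)) : 0 < z.1 -> 0 < (S z).1 by move=> z0; exact: mulr_gt0.
split.
- move=> t x t0; by rewrite mulr_ge0 ?(ltW c20)// u0// mulr_ge0 ?(ltW c20).
- have SD' (z : R * (R * R)) : 0 <= z.1 -> 0 <= (S z).1 by move=> z0; apply: mulr_ge0 => //; exact: ltW.
  have H := within_continuous_compl cS SD' cu.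
  move=> z.
  by apply: cvgM; [exact: cvg_cst|exact: H].
- split.
  + by move=> t x t0; apply: (ex_derive (is_derive := dtE t x t0)).
  + by move=> v t x t0; apply: (ex_derive (is_derive := dxE v t x t0)).
  + by move=> v w t x t0; apply: (ex_derive (is_derive := ddxE v w t x t0)).
  + have H := within_continuous_compl cS SD cdt.
    have {}H : {within [set z : R * (R * R) | 0 < z.1], continuous
        (fun z => c ^+ 2 * c ^+ 2 * 'D_1 (u ^~ (S z).2) (S z).1)}.
      by move=> z; apply: cvgM; [exact: cvg_cst|exact: H].
    apply: subspace_eq_continuous H => z; rewrite inE /= => z0.
    by apply/esym/derive_val; exact: dtE.
  + move=> v w; split.
      have H := within_continuous_compl cS SD (cdx v w).1.
      have {}H : {within [set z : R * (R * R) | 0 < z.1], continuous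
          (fun z => c ^+ 2 * c * 'D_v (u (S z).1) (S z).2)}.
        by move=> z; apply: cvgM; [exact: cvg_cst|exact: H].
      apply: subspace_eq_continuous H => z; rewrite inE /= => z0.
      by apply/esym/derive_val; exact: dxE.
    have H := within_continuous_compl cS SD (cdx v w).2.
    have {}H : {within [set z : R * (R * R) | 0 < z.1], continuous
        (fun z => c ^+ 2 * c * c * 'D_w ('D_v (u (S z).1)) (S z).2)}.
      by move=> z; apply: cvgM; [exact: cvg_cst|exact: H].
    apply: subspace_eq_continuous H => z; rewrite inE /= => z0.
    by apply/esym/derive_val; exact: ddxE.
- move=> t x t0; rewrite (derive_val (is_derive := dtE t x t0)) pde ?mulr_gt0//.
  have -> : laplacian (fun x => c ^+ 2 * u (c ^+ 2 * t) (c *: x)) x =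
      c ^+ 2 * c * c * laplacian (u (c ^+ 2 * t)) (c *: x).
    by rewrite /laplacian mulrDr; congr (_ + _); apply: derive_val; exact: ddxE.
  ring.
- by move=> x; rewrite mulr0 ui.
Qed.

End scaling.

(** * Open sets and open boxes generate the measurable sets of the plane *)

Section plane_measurability.
Context {R : realType}.

Definition boxes : set (set (plane R)) :=
  [set B | exists a b c d : R, B = `]a, b[ `*` `]c, d[].

(** An open set is the union of the rational boxes that it contains, and there are countably many of
    them. *)
Lemma open_measurable_plane (U : set (R * R)) :
  open U -> measurable (U : set (plane R)).
Proof.
move=> oU.
pose B (q : rat * rat * rat * rat) : set (plane R) :=
  [set x : R * R | ratr q.1.1.1 < x.1 < ratr q.1.1.2 /\ ratr q.1.2 < x.2 < ratr q.2].
pose F q := if `[< B q `<=` U >] then B q else set0.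
have -> : U = \bigcup_q F q.
  apply/seteqP; split => [x Ux|x [q _]]; last first.
    by rewrite /F; case: ifPn => // /asboolP; exact.
  move: oU; rewrite openE => /(_ _ Ux) /nbhs_ballP[e /= e0 xeU].
  have [a] : exists a, (ratr a : R) \in `](x.1 - e), (x.1)[ by apply: rat_in_itvoo; lra.
  rewrite in_itv /= => /andP[a1 a2].
  have [b] : exists a, (ratr a : R) \in `](x.1), (x.1 + e)[ by apply: rat_in_itvoo; lra.
  rewrite in_itv /= => /andP[b1 b2].
  have [c] : exists a, (ratr a : R) \in `](x.2 - e), (x.2)[ by apply: rat_in_itvoo; lra.
  rewrite in_itv /= => /andP[c1 c2].
  have [d] : exists a, (ratr a : R) \in `](x.2), (x.2 + e)[ by apply: rat_in_itvoo; lra.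
  rewrite in_itv /= => /andP[d1 d2].
  exists (a, b, c, d) => //; rewrite /F /=.
  rewrite asboolT; first by rewrite /B /= a2 b1 c2 d1.
  move=> y [] /= /andP[y1 y2] /andP[y3 y4]; apply: xeU.
  by split; rewrite /ball /= ltr_norml; apply/andP; split; lra.
apply: countable_bigcupT_measurable; first exact: countableP.
move=> q; rewrite /F; case: ifPn => // _.
have -> : B q = `](ratr q.1.1.1), (ratr q.1.1.2)[ `*` `](ratr q.1.2), (ratr q.2)[.
  by apply/seteqP; split => x /=; rewrite !in_itv.
by apply: measurableX; exact: measurable_itv.
Qed.

Lemma continuous_measurable_plane (f : R * R -> R) :
  continuous f -> measurable_fun setT (f : plane R -> measurableTypeR R).
Proof.
move=> cf; apply: (measurability _ (RGenOpens.measurableE R)).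
move=> _ [_ [a [b ->] <-]]; rewrite setTI; apply: open_measurable_plane.
by move/continuousP : cf; apply; exact: interval_open.
Qed.

(** Strips are increasing unions of boxes, and they yield all preimages under the two projections.
    Together with [boxes_setI_closed] this makes the boxes a generating pi-system for the Dynkin
    argument in [measurable_Mp_ev]. *)
Lemma measurable_boxes : @measurable _ (plane R) = <<s boxes >>.
Proof.
apply/seteqP; split; last first.
  apply: smallest_sub; first exact: sigma_algebra_measurable.
  move=> _ [a [b [c [d ->]]]].
  by apply: measurableX; exact: measurable_itv.
have H1 a b : <<s boxes >> (`]a, b[ `*` setT).
  have -> : `]a, b[ `*` setT = \bigcup_n (`]a, b[ `*` `](- n%:R), n%:R[) :> set (plane R).
    apply/seteqP; split => [x [x1 _]|x [n _] [x1 _]] //.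
    have [n xn] : exists n, `|x.2| < n%:R by exists (Num.truncn `|x.2|).+1; exact: truncnS_gt.
    by exists n => //; split => //=; rewrite in_itv /= -ltr_norml.
  apply: sigma_algebra_bigcup => n; apply: sub_sigma_algebra.
  by exists a, b, (- n%:R), n%:R.
have H2 a b : <<s boxes >> (setT `*` `]a, b[).
  have -> : setT `*` `]a, b[ = \bigcup_n (`](- n%:R), n%:R[ `*` `]a, b[) :> set (plane R).
    apply/seteqP; split => [x [_ x1]|x [n _] [_ x1]] //.
    have [n xn] : exists n, `|x.1| < n%:R by exists (Num.truncn `|x.1|).+1; exact: truncnS_gt.
    by exists n => //; split => //=; rewrite in_itv /= -ltr_norml.
  apply: sigma_algebra_bigcup => n; apply: sub_sigma_algebra.
  by exists (- n%:R), n%:R, a, b.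
have G1 (f : plane R -> R) : (forall a b, <<s boxes >> (f @^-1` `]a, b[)) ->
    preimage_set_system setT f (@measurable _ (measurableTypeR R)) `<=` <<s boxes >>.
  move=> Hf.
  have -> : @measurable _ (measurableTypeR R) = <<s @RGenOpens.G R >>.
    exact: RGenOpens.measurableE.
  rewrite -(@g_sigma_preimageE (plane R) (measurableTypeR R) setT f).
  apply: smallest_sub; first exact: smallest_sigma_algebra.
  by move=> _ [_ [a [b ->]] <-]; rewrite setTI.
apply: smallest_sub; first exact: smallest_sigma_algebra.
rewrite subUset; split; apply: G1 => a b.
  by have := H1 a b; rewrite (_ : _ `*` _ = fst @^-1` `]a, b[)// predeqE => x; split => // -[].
by have := H2 a b; rewrite (_ : _ `*` _ = snd @^-1` `]a, b[)// predeqE => x; split => // -[].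
Qed.

Lemma boxes_setI_closed : setI_closed boxes.
Proof.
move=> _ _ [a [b [c [d ->]]]] [a' [b' [c' [d' ->]]]].
exists (Num.max a a'), (Num.min b b'), (Num.max c c'), (Num.min d d').
rewrite -setXI; congr (_ `*` _); apply/seteqP; split => x /=;
  rewrite !in_itv /= gt_max lt_min.
- by move=> [/andP[-> ->] /andP[-> ->]].
- by move=> /andP[/andP[-> ->] /andP[-> ->]].
- by move=> [/andP[-> ->] /andP[-> ->]].
- by move=> /andP[/andP[-> ->] /andP[-> ->]].
Qed.

End plane_measurability.

Section continuity.
Context {R : realType} {T : topologicalType}.
Implicit Types f g : T -> R.

Lemma continuous_minr f g : continuous f -> continuous g ->
  continuous (fun x => Num.min (f x) (g x)).
Proof. by move=> cf cg x; apply: continuous_min; [exact: cf|exact: cg]. Qed.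

Lemma continuous_maxr f g : continuous f -> continuous g ->
  continuous (fun x => Num.max (f x) (g x)).
Proof. by move=> cf cg x; apply: continuous_max; [exact: cf|exact: cg]. Qed.

End continuity.

(** * Evaluations and integrals as measurable functions on the space of measures *)

Section Mp_measurability.
Context {R : realType} {p : R}.
Implicit Types (nu : Mp p) (g : R * R -> R).

(** Nonnegativity is included so that integrals can be taken in [\bar R]; they are finite on [Mp p],
    hence agree with the real integrals that define its topology. *)
Definition compactly_supported g := [/\ continuous g, forall x, 0 <= g x &
  compact (closure [set x | g x != 0])].

Lemma compact_support g (K : set (R * R)) : compact K ->
  (forall x, g x != 0 -> K x) -> compact (closure [set x | g x != 0]).
Proof.
move=> cK gK; apply: (subclosed_compact _ cK); first exact: closed_closure.
have clK : closed K by apply: compact_closed => //; exact: norm_hausdorff.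
by rewrite [X in _ `<=` X](closure_id _).1//; exact: closure_subset.
Qed.

Lemma compactly_supported_test g :
  compactly_supported g -> test_function p g.
Proof. by case=> cg _ sg; exists g, 0; split => // x; rewrite mul0r addr0. Qed.

Lemma compactly_supported_bounded g : compactly_supported g ->
  exists2 M, 0 <= M & forall x, g x <= M.
Proof.
move=> [cg g0 sg].
have [Z|/set0P K0] := eqVneq (closure [set x | g x != 0]) set0.
  exists 0 => // x; rewrite leNgt; apply/negP => gx.
  have : closure [set x | g x != 0] x by apply: subset_closure; rewrite /= gt_eqF.
  by rewrite Z.
have [c _ Hc] := compact_EVT_max K0 sg (continuous_subspaceT cg).
exists (g c) => // x; have [->//|gx] := eqVneq (g x) 0.
by apply: Hc; rewrite inE; exact: subset_closure.
Qed.

Lemma Mp_integral_fin nu g : compactly_supported g ->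
  (\int[nu]_x (g x)%:E < +oo)%E.
Proof.
move=> ccg; have [M M0 gM] := compactly_supported_bounded ccg.
have [cg g0 sg] := ccg.
set K := closure [set x | g x != 0].
have mK : measurable (K : set (plane R)).
  rewrite -[X in measurable X]setCK; apply: measurableC; apply: open_measurable_plane.
  by apply: closed_openC; exact: closed_closure.
have mg : measurable_fun setT (fun x : plane R => (g x)%:E).
  by apply/measurable_EFinP; exact: continuous_measurable_plane.
apply: (@le_lt_trans _ _ (\int[nu]_x (M%:E * (\1_K x)%:E))%E).
  apply: ge0_le_integral => //.
  - by move=> x _; rewrite lee_fin.
  - apply: measurable_funeM; apply/measurable_EFinP.
    exact: measurable_indic.
  - move=> x _; rewrite -EFinM lee_fin indicE.
    have [->|gx] := eqVneq (g x) 0; first by rewrite mulr_ge0.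
    by rewrite mem_set ?mulr1//; exact: subset_closure.
rewrite ge0_integralZl//.
  rewrite integral_indic// setIT; apply: lte_mul_pinfty => //.
  exact: Mp_locally_finite.
by apply/measurable_EFinP; exact: measurable_indic.
Qed.

Lemma Mp_integral_fineK nu g : compactly_supported g ->
  ((\int[nu]_x g x)%R%:E = \int[nu]_x (g x)%:E)%E.
Proof.
move=> ccg; rewrite /Rintegral fineK// ge0_fin_numE ?Mp_integral_fin//.
by apply: integral_ge0 => x _; rewrite lee_fin; case: ccg.
Qed.

Lemma Mp_integral_continuous g : test_function p g ->
  continuous (fun nu => \int[nu]_x g x : R).
Proof.
move=> tg nu.
have C1 : continuous (@Mp_eval R p) by exact: initial_continuous.
pose i : {f | test_function p f} := exist _ g tg.
have C2 := @proj_continuous {classic {f | test_function p f}} (fun=> R) i.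
exact: (continuous_comp (C1 nu) (C2 _)).
Qed.

Lemma measurable_Mp_Rintegral g : test_function p g ->
  measurable_fun setT (fun nu => \int[nu]_x g x : measurableTypeR R).
Proof.
move=> /Mp_integral_continuous/continuousP cg.
apply: (measurability _ (RGenOpens.measurableE R)).
move=> _ [_ [a [b ->] <-]]; rewrite setTI; apply: sub_sigma_algebra.
by apply: cg; exact: interval_open.
Qed.

Lemma measurable_Mp_integral g : compactly_supported g ->
  measurable_fun setT (fun nu => \int[nu]_x (g x)%:E)%E.
Proof.
move=> ccg.
under eq_fun do rewrite -Mp_integral_fineK//.
apply/measurable_EFinP; apply: measurable_Mp_Rintegral.
exact: compactly_supported_test.
Qed.

(** On the box the inner minimum is the max-norm distance to the complement, so these bumps increase
    with [n] to the indicator of the open box. *)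
Definition box_bump (a b c d : R) (n : nat) (x : R * R) : R :=
  Num.min 1 (n%:R * Num.max 0
    (Num.min (Num.min (x.1 - a) (b - x.1)) (Num.min (x.2 - c) (d - x.2)))).

Lemma box_bump_out a b c d n x : ~ (`]a, b[ `*` `]c, d[) x ->
  box_bump a b c d n x = 0.
Proof.
move=> H; rewrite /box_bump; set M := Num.min (Num.min _ _) _.
have M0 : M <= 0.
  rewrite leNgt; apply/negP; rewrite !lt_min !subr_gt0.
  move=> /andP[/andP[x1 x2] /andP[x3 x4]]; apply: H.
  by rewrite /= !in_itv /= x1 x2 x3 x4.
by rewrite (max_l M0) mulr0 min_r.
Qed.

Lemma box_bump_compactly_supported a b c d n :
  compactly_supported (box_bump a b c d n).
Proof.
split.
- apply: continuous_minr; first by move=> x; exact: cvg_cst.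
  move=> x; apply: cvgM; first exact: cvg_cst.
  move: x; apply: continuous_maxr; first by move=> x; exact: cvg_cst.
  by apply: continuous_minr; apply: continuous_minr => x; apply: cvgB;
    [exact: cvg_fst|exact: cvg_cst|exact: cvg_cst|exact: cvg_fst
    |exact: cvg_snd|exact: cvg_cst|exact: cvg_cst|exact: cvg_snd].
- by move=> x; rewrite le_min ler01 mulr_ge0// le_max lexx.
- apply: (@compact_support _ (`[a, b] `*` `[c, d])).
    by apply: compact_setX; exact: segment_compact.
  move=> x; apply: contra_neqP => xK; apply: box_bump_out => H; apply: xK.
  case: H => /=; rewrite !in_itv /= => /andP[x1 x2] /andP[x3 x4].
  by rewrite !ltW.
Qed.

Lemma box_bump_nondecreasing a b c d x :
  {homo (fun n => box_bump a b c d n x) : m n / (m <= n)%N >-> m <= n}.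
Proof.
move=> m n mn; rewrite /box_bump.
set M := Num.max 0 _.
have M0 : 0 <= M by rewrite le_max lexx.
have : m%:R * M <= n%:R * M by rewrite ler_wpM2r// ler_nat.
by move=> H; rewrite le_min ge_min lexx /= ge_min H orbT.
Qed.

Lemma box_bump_cvg a b c d (x : plane R) :
  (box_bump a b c d n x)%:E @[n --> \oo] --> (\1_(`]a, b[ `*` `]c, d[) x)%:E.
Proof.
apply: cvg_EFin; first by near=> n.
rewrite indicE; case: (boolP (x \in _)) => [|].
  rewrite inE /= !in_itv /= => -[/andP[x1 x2] /andP[x3 x4]].
  apply: cvg_near_cst; near=> n.
  rewrite /= /box_bump.
  set M := Num.max 0 _.
  have M0 : 0 < M by rewrite lt_max !lt_min !subr_gt0 x1 x2 x3 x4 orbT.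
  apply: min_l; rewrite -ler_pdivrMr// mul1r ltW//.
  near: n; exact: nbhs_infty_gtr.
move=> /negP H.
suff E n : box_bump a b c d n x = 0 by under eq_fun do rewrite E; exact: cvg_cst.
by apply: box_bump_out => Hx; apply: H; rewrite inE.
Unshelve. all: by end_near. Qed.

Lemma measurable_Mp_box a b c d :
  measurable_fun setT (fun nu => nu (`]a, b[ `*` `]c, d[)).
Proof.
pose f n nu := (\int[nu]_x (box_bump a b c d n x)%:E)%E.
apply: (emeasurable_fun_cvg f).
  by move=> n; apply: measurable_Mp_integral; exact: box_bump_compactly_supported.
move=> nu _; rewrite /f.
have mB : measurable (`]a, b[ `*` `]c, d[ : set (plane R)).
  by apply: measurableX; exact: measurable_itv.
have -> : nu (`]a, b[ `*` `]c, d[) =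
    (\int[nu]_x limn (fun n => (box_bump a b c d n x)%:E))%E.
  under eq_integral => x _ do rewrite (cvg_lim _ (@box_bump_cvg a b c d x))//.
  by rewrite integral_indic// setIT.
apply: cvg_monotone_convergence => //.
- move=> n; apply/measurable_EFinP; apply: continuous_measurable_plane.
  by case: (box_bump_compactly_supported a b c d n).
- by move=> n x _; rewrite lee_fin; case: (box_bump_compactly_supported a b c d n).
- by move=> x _ m n mn; rewrite lee_fin; exact: box_bump_nondecreasing.
Qed.

(** This links the topological sigma-algebra of [Mp p] with the values of the measures. Boxes are
    monotone limits of continuous bumps; a Dynkin argument reaches the other Borel sets. *)
Lemma measurable_Mp_ev (B : set (plane R)) : measurable B ->
  measurable_fun setT (fun nu => nu B).
Proof.
move=> mB.
(* A measure in [Mp p] may have infinite total mass, while complements require a subtraction: the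
   induction is run inside bounded squares, which then exhaust the plane. *)
pose Q (n : nat) : set (plane R) := `](- n%:R), n%:R[ `*` `](- n%:R), n%:R[.
have mQ n : measurable (Q n) by apply: measurableX; exact: measurable_itv.
have Qfin nu n : (nu (Q n) < +oo)%E.
  apply: (@le_lt_trans _ _ (nu (`[(- n%:R), n%:R] `*` `[(- n%:R), n%:R]))).
    apply: le_measure; rewrite ?inE//; first by apply: measurableX; exact: measurable_itv.
    by move=> x [] /=; rewrite !in_itv /= => /andP[x1 x2] /andP[x3 x4]; rewrite !ltW.
  by apply: Mp_locally_finite; apply: compact_setX; exact: segment_compact.
have UQ : \bigcup_n Q n = setT.
  apply/seteqP; split => // x _.
  exists (Num.truncn (`|x.1| + `|x.2|)).+1 => //.
  have H := truncnS_gt (`|x.1| + `|x.2|).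
  have ? := normr_ge0 x.1; have ? := normr_ge0 x.2.
  by split; rewrite /= in_itv /= -ltr_norml; apply: le_lt_trans H; lra.
suff H n S : <<s boxes >> S -> measurable_fun setT (fun nu => nu (S `&` Q n)).
  apply: (emeasurable_fun_cvg (fun n nu => nu (B `&` Q n))).
    by move=> n; apply: H; rewrite -measurable_boxes.
  move=> nu _; rewrite -{2}(setIT B) -UQ setI_bigcupr.
  apply: nondecreasing_cvg_mu.
  - by move=> n; exact: measurableI.
  - by apply: bigcupT_measurable => n; exact: measurableI.
  - move=> m n mn; apply/subsetPset; apply: setIS => x [] /=.
    rewrite !in_itv /= => /andP[x1 x2] /andP[x3 x4].
    have mn' : (m%:R : R) <= n%:R by rewrite ler_nat.
    have Nmn : - (n%:R : R) <= - m%:R by rewrite lerN2.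
    split; rewrite /= in_itv /=.
      by rewrite (le_lt_trans Nmn x1) (lt_le_trans x2 mn').
    by rewrite (le_lt_trans Nmn x3) (lt_le_trans x4 mn').
move: S; apply: dynkin_induction.
- exact: measurable_boxes.
- exact: boxes_setI_closed.
- under eq_fun do rewrite setTI.
  exact: measurable_Mp_box.
- move=> S bS.
  have [a [b [c [d E]]]] : boxes (S `&` Q n).
    by apply: boxes_setI_closed => //; do 4 eexists.
  by under eq_fun do rewrite E; exact: measurable_Mp_box.
- move=> S mS HS.
  apply: (eq_measurable_fun (fun nu => nu (Q n) - nu (S `&` Q n))%E).
    move=> nu _; rewrite (setIC _ (Q n)) -setDE measureD//; last exact: Qfin.
    by rewrite (setIC (Q n)).
  by apply: emeasurable_funB => //; exact: measurable_Mp_box.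
- move=> F mF tF HF.
  apply: (eq_measurable_fun (fun nu => \sum_(0 <= k <oo) nu (F k `&` Q n)))%E.
    move=> nu _; rewrite setI_bigcupl measure_semi_bigcup//.
    + by move=> k; exact: measurableI.
    + exact: trivIset_setIr.
    + by apply: bigcupT_measurable => k; exact: measurableI.
  exact: ge0_emeasurable_sum.
Qed.

End Mp_measurability.

Lemma bounded_convergence d (T : measurableType d) (R : realType)
    (mu : {measure set T -> \bar R}) (f_ : nat -> T -> \bar R) (f : T -> \bar R) :
  (mu setT < +oo)%E -> (forall n, measurable_fun setT (f_ n)) ->
  (forall n x, 0 <= f_ n x <= 1)%E -> (forall x, f_ n x @[n --> \oo] --> f x) ->
  (\int[mu]_x f_ n x)%E @[n --> \oo] --> (\int[mu]_x f x)%E.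
Proof.
move=> mufin mf f01 ff.
have mf' : measurable_fun setT f by apply: (emeasurable_fun_cvg f_) => // x _.
have := @dominated_convergence _ _ _ mu _ measurableT f_ f (cst 1%E) mf mf'.
have int1 : mu.-integrable setT (cst 1%E).
  apply/integrableP; split; first exact: measurable_cst.
  under eq_integral => x _ do rewrite gee0_abs ?lee01//.
  by rewrite integral_cst// mul1e.
move=> H; have [] // := H _ int1 _; first by apply: aeW => x _; exact: ff.
by apply: aeW => x n _ /=; have /andP[? ?] := f01 n x; rewrite gee0_abs.
Qed.

(** * Empty discs seen through cone-shaped test functions *)

Section holes.
Context {R : realType} {p : R}.
Implicit Types (nu : Mp p) (v k : R).

(** Positive exactly on [disc v], continuous and compactly supported: it detects mass in the open
    disc and is an admissible argument of the Laplace functional. *)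
Definition cone v (x : R * R) : R := Num.max 0 (v - enorm x).

Lemma sqr_enorm (x : R * R) : enorm x ^+ 2 = x.1 ^+ 2 + x.2 ^+ 2.
Proof. by rewrite sqr_sqrtr// addr_ge0// sqr_ge0. Qed.

Lemma enorm_ge0 (x : R * R) : 0 <= enorm x.
Proof. exact: sqrtr_ge0. Qed.

Lemma continuous_enorm : continuous (@enorm R).
Proof.
have -> : @enorm R = fun x => Num.sqrt (sqdist x (0, 0)).
  by apply/funext => x; rewrite /enorm /sqdist /= !subr0.
move=> x; apply: (@continuous_comp _ _ _ (sqdist ^~ (0, 0)) Num.sqrt).
  exact: continuous_sqdist.
exact: sqrt_continuous.
Qed.

Lemma measurable_disc v : measurable (disc v : set (plane R)).
Proof.
apply: open_measurable_plane; rewrite /disc.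
rewrite (_ : [set x | _] = @enorm R @^-1` [set r | r < v])//.
by apply: open_comp => //; move=> x _; exact: continuous_enorm.
Qed.

Lemma disc_compact v : disc v `<=` cball (0, 0) (v ^+ 2).
Proof.
move=> x; rewrite /disc /cball /sqdist /= !subr0 -sqr_enorm => xv.
have x0 := enorm_ge0 x.
have v0 : 0 <= v by rewrite (le_trans x0)// ltW.
by rewrite ler_sqr ?nnegrE// ltW.
Qed.

Lemma cone_ge0 v x : 0 <= cone v x.
Proof. by rewrite le_max lexx. Qed.

Lemma cone_neq0 v x : (cone v x != 0) = (enorm x < v).
Proof.
rewrite /cone; have [H|H] := ltP (enorm x) v.
  by rewrite max_r ?subr_ge0 ?ltW// gt_eqF// subr_gt0.
by rewrite max_l ?subr_le0// eqxx.
Qed.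

Lemma cone_compactly_supported v k : 0 <= k ->
  compactly_supported (fun x => k * cone v x).
Proof.
move=> k0; split.
- move=> x; apply: cvgM; first exact: cvg_cst.
  move: x; apply: continuous_maxr => x; first exact: cvg_cst.
  by apply: cvgB; [exact: cvg_cst|exact: continuous_enorm].
- by move=> x; rewrite mulr_ge0// cone_ge0.
- apply: (@compact_support _ _ (cball (0, 0) (v ^+ 2))); first exact: compact_cball.
  move=> x H; apply: disc_compact; rewrite /disc /= -cone_neq0.
  by apply: contra_neq H => ->; rewrite mulr0.
Qed.

Lemma cone_admissible v k : 0 < p -> 0 <= k -> admissible p (fun x => k * cone v x).
Proof.
move=> p0 k0; have [c1 c2 c3] := cone_compactly_supported v k0.
(* On the disc, [cone v] is at most [|v|] and [phi_ p] is at least [(1 + v^2)^(- p / 2)]; outside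
   the disc the cone vanishes. *)
split => //; exists (k * `|v| * (1 + v ^+ 2) `^ (p / 2)) => _ [x _ <-].
have phi0 : 0 < phi_ p x by apply: powR_gt0; rewrite ltr_pwDl// sqr_ge0.
rewrite ler_pdivrMr//.
have x0 := enorm_ge0 x.
have [xv|xv] := ltP (enorm x) v; last first.
  have -> : cone v x = 0 by apply/eqP; rewrite -[_ == _]negbK cone_neq0 -leNgt.
  by rewrite mulr0 !mulr_ge0 ?powR_ge0.
have v0 : 0 <= v by rewrite (le_trans x0)// ltW.
have H : 1 <= (1 + v ^+ 2) `^ (p / 2) * phi_ p x.
  have B0 : 0 < (1 + enorm x ^+ 2) `^ (p / 2).
    by rewrite powR_gt0// ltr_pwDl// sqr_ge0.
  rewrite /phi_ mulNr powRN ler_pdivlMr// mul1r; apply: ge0_ler_powR; rewrite ?nnegrE ?addr_ge0 ?sqr_ge0//.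
    by rewrite divr_ge0// ltW.
  by rewrite lerD2l ler_sqr ?nnegrE// ltW.
rewrite -!mulrA ler_wpM2l// (ger0_norm v0) (le_trans (y := v))//.
  by rewrite /cone ge_max v0 gerBl.
by rewrite ler_peMr.
Qed.

Lemma cone_measurable v k : 0 <= k ->
  measurable_fun setT (fun x : plane R => (k * cone v x)%:E).
Proof.
move=> k0; apply/measurable_EFinP; apply: continuous_measurable_plane.
by case: (cone_compactly_supported v k0).
Qed.

Lemma cone_integral0 nu v :
  (\int[nu]_x (cone v x)%:E = 0)%E <-> nu (disc v) = 0%E.
Proof.
have mb : measurable_fun setT (fun x : plane R => (cone v x)%:E).
  apply/measurable_EFinP; apply: continuous_measurable_plane.
  have [] := @cone_compactly_supported v 1 ler01.
  by under eq_fun do rewrite mul1r.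
have := ae_eq_integral_abs nu measurableT mb.
under eq_integral => x _ do rewrite gee0_abs ?lee_fin ?cone_ge0//.
move=> ->; rewrite -(negligibleP nu (measurable_disc v)).
have -> : disc v = ~` [set x : plane R | setT x -> (cone v x)%:E = cst 0%E x].
  apply/seteqP; split => x /=; rewrite /disc /= -cone_neq0.
    by move=> /eqP H /(_ I) [] /H.
  by move=> H; apply/eqP => H2; apply: H; rewrite H2.
by [].
Qed.

Definition null_disc v : set (Mp p) := [set nu | nu (disc v) = 0%E].

Lemma measurable_null_disc v : measurable (null_disc v).
Proof.
have := @measurable_Mp_ev R p _ (measurable_disc v).
move=> /(_ measurableT [set 0%E]); rewrite setTI; apply.
exact: emeasurable_set1.
Qed.

(** The supremum is attained: the discs are open, so [disc v] is a countable union of discs of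
    smaller radius, each of them null. *)
Lemma hole_radius_ge nu v : 0 < v ->
  (v%:E <= hole_radius nu)%E <-> nu (disc v) = 0%E.
Proof.
move=> v0; split => [|H]; last first.
  by rewrite /hole_radius le_max; apply/orP; right; apply: ereal_sup_ubound; exists v.
have v0' : (v%:E <= 0)%E = false by apply/negbTE; rewrite -ltNge lte_fin.
rewrite /hole_radius le_max v0' /= => H.
have dvU : disc v = \bigcup_n disc (v - n.+1%:R^-1).
  apply/seteqP; split => [x xv|x [n _]]; last first.
    by rewrite /disc /= => /lt_trans; apply; rewrite gtrBl invr_gt0.
  have e0 : 0 < v - enorm x by rewrite subr_gt0.
  exists (Num.truncn (v - enorm x)^-1) => //.
  rewrite /disc /= ltrBrDl -ltrBrDr invf_plt ?posrE//.
  exact: truncnS_gt.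
rewrite -(negligibleP nu (measurable_disc v)) dvU.
apply: negligible_bigcup => n; apply/negligibleP; first exact: measurable_disc.
have : ((v - n.+1%:R^-1)%:E < ereal_sup [set u%:E | u in [set u | (0 < u)%R /\ nu (disc u) = 0%E]])%E.
  by apply: lt_le_trans H; rewrite lte_fin gtrBl invr_gt0.
move=> /ereal_sup_gt[_ [w [w0 nw] <-]]; rewrite lte_fin => vw.
apply/eqP; rewrite -measure_le0 -nw; apply: le_measure; rewrite ?inE.
- exact: measurable_disc.
- exact: measurable_disc.
- by move=> x; rewrite /disc /= => /lt_trans; apply.
Qed.

End holes.

(** * Solutions attached to a transition kernel and the probability of an empty disc *)

Section transition.
Context {R : realType} {p : R}.
Implicit Types (mu nu : Mp p) (v k : R).

(** Chosen from the equation alone, without reference to a kernel; the default 0 occurs only when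
    there is no unique positive solution, which [sbm_transition] excludes for admissible data. *)
Definition solution (phi : R * R -> R) : R -> R * R -> R :=
  xget (fun=> fun=> 0) [set u | unique_positive_solution phi u].

Definition cone_solution v k := solution (fun x => k * cone v x).

Fact dirac_locally_finite (x : plane R) :
  locally_finite (@dirac _ (plane R) x R).
Proof. by move=> K _; rewrite /= /dirac ltry. Qed.

Fact dirac_tempered (x : plane R) :
  (\int[@dirac _ (plane R) x R]_y (phi_ p y)%:E < +oo)%E.
Proof.
rewrite integral_dirac//; first by rewrite diracT mul1e ltry.
apply/measurable_EFinP.
apply: (@measurableT_comp _ _ _ _ _ _ (fun z : measurableTypeR R => z `^ (- p / 2)) _
  (fun y : plane R => 1 + enorm y ^+ 2)); first exact: measurable_powR.
apply: continuous_measurable_plane => y; apply: cvgD; first exact: cvg_cst.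
have C := @continuous_enorm R y.
by under eq_fun do rewrite expr2; rewrite expr2; apply: cvgM.
Qed.

(** Started from a unit mass at [x], the process has Laplace functional [exp(- u(t, x))], so facts
    about kernels become pointwise facts about solutions. *)
Definition dirac_Mp (x : plane R) : Mp p :=
  MkMp (dirac_locally_finite x) (dirac_tempered x).

Variables (Q : R -> R.-pker (Mp p) ~> (Mp p)).
Hypothesis hQ : sbm_transition Q.
Hypothesis p0 : 0 < p.

Lemma solution_unique_positive phi : admissible p phi ->
  unique_positive_solution phi (solution phi).
Proof.
move=> /hQ[u [hu _]]; rewrite /solution.
by case: xgetP => [w _ //|/(_ u)].
Qed.

Lemma solution_positive phi : admissible p phi ->
  positive_solution phi (solution phi).
Proof. by case/solution_unique_positive. Qed.

Lemma solution_ge0 phi t x : admissible p phi -> 0 <= t ->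
  0 <= solution phi t x.
Proof. by move=> /solution_positive[h _ _ _ _]; exact: h. Qed.

Lemma solutionE phi w t x : admissible p phi -> positive_solution phi w ->
  0 <= t -> w t x = solution phi t x.
Proof. by case/solution_unique_positive => _ H pw t0; exact: H. Qed.

Lemma solution_continuous phi t : admissible p phi -> 0 <= t ->
  continuous (solution phi t).
Proof.
move=> /solution_positive[_ /subspace_continuousP cu _ _ _] t0 x.
have C : (t, y) @[y --> x] --> (t, x).
  exact: (cvg_pair (cvg_cst (F := nbhs x) t) (@cvg_id _ (nbhs x))).
have G : (t, y) @[y --> x] --> within [set z : R * (R * R) | 0 <= z.1] (nbhs (t, x)).
  move=> B HB.
  have H : \forall y \near x, 0 <= t -> B (t, y) by exact: (C _ HB).
  by apply: (@filterS _ (nbhs x) _ _ _ _ H) => y; apply.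
exact: (cvg_comp _ _ G (cu (t, x) t0)).
Qed.

Lemma solution_measurable phi t : admissible p phi -> 0 <= t ->
  measurable_fun setT (fun x : plane R => (solution phi t x)%:E).
Proof.
move=> aphi t0; apply/measurable_EFinP; apply: continuous_measurable_plane.
exact: solution_continuous.
Qed.

Lemma laplace_transition phi t mu : admissible p phi -> 0 <= t ->
  (\int[Q t mu]_nu expeR (- \int[nu]_x (phi x)%:E) =
   expeR (- \int[mu]_x (solution phi t x)%:E))%E.
Proof.
move=> aphi t0; have [u [[pu _] ->//]] := hQ aphi.
by congr (expeR (- _)%E); apply: eq_integral => x _; rewrite (solutionE _ aphi pu).
Qed.

Lemma laplace_measurable g : compactly_supported g ->
  measurable_fun setT (fun nu => expeR (- \int[nu]_x (g x)%:E))%E.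
Proof.
move=> ccg; under eq_fun do rewrite -Mp_integral_fineK//=.
apply/measurable_EFinP; apply: measurableT_comp; first exact: measurable_expR.
apply: measurableT_comp; first exact: oppr_measurable.
by apply: measurable_Mp_Rintegral; exact: compactly_supported_test.
Qed.

(** A larger test function has a smaller Laplace functional. Applied to the process started from a
    unit mass at [x], this is monotonicity of the solution at [x] in its datum. *)
Lemma cone_solution_le v k k' t x : 0 <= k -> k <= k' -> 0 <= t ->
  cone_solution v k t x <= cone_solution v k' t x.
Proof.
move=> k0 kk t0; have k'0 : 0 <= k' by exact: le_trans kk.
have E l : 0 <= l -> (\int[Q t (dirac_Mp x)]_nu expeR (- \int[nu]_y (l * cone v y)%:E) =
    (expR (- cone_solution v l t x))%:E)%E.
  move=> l0; rewrite laplace_transition//; last exact: cone_admissible.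
  rewrite integral_dirac//; first by rewrite diracT mul1e.
  by apply: solution_measurable => //; exact: cone_admissible.
rewrite -lerN2 -ler_expR -lee_fin -!E//.
apply: ge0_le_integral => //.
- by move=> nu _; exact: expeR_ge0.
- by apply: laplace_measurable; exact: cone_compactly_supported.
- by apply: laplace_measurable; exact: cone_compactly_supported.
- move=> nu _; rewrite lee_expeR leeN2; apply: ge0_le_integral => //.
  + by move=> y _; rewrite lee_fin mulr_ge0// cone_ge0.
  + exact: cone_measurable.
  + exact: cone_measurable.
  + by move=> y _; rewrite lee_fin ler_wpM2r// cone_ge0.
Qed.

(** With I the integral of the cone, [exp(- n c I)] tends to the indicator of [I = 0], that is, of
    an empty disc. The step [c] is left free because the rescaled problem uses slopes that are
    multiples of [t^(-3/2)]. *)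
Lemma transition_null_disc v t mu (c : R) : 0 < c -> 0 <= t ->
  expeR (- \int[mu]_x (cone_solution v (n%:R * c) t x)%:E)%E @[n --> \oo]
  --> Q t mu (null_disc v).
Proof.
move=> c0 t0.
have k0 n : 0 <= n%:R * c by rewrite mulr_ge0// ltW.
have ccb : compactly_supported (cone v).
  have := @cone_compactly_supported R v 1 ler01.
  by congr compactly_supported; apply/funext => x; rewrite mul1r.
have -> : (fun n => expeR (- \int[mu]_x (cone_solution v (n%:R * c) t x)%:E)%E) =
    (fun n => \int[Q t mu]_nu expeR (- \int[nu]_x (n%:R * c * cone v x)%:E))%E.
  by apply/funext => n; rewrite laplace_transition//; exact: cone_admissible.
have -> : Q t mu (null_disc v) = (\int[Q t mu]_nu (\1_(null_disc v) nu)%:E)%E.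
  by rewrite integral_indic// ?setIT//; exact: measurable_null_disc.
apply: bounded_convergence.
- by rewrite prob_kernel ltry.
- by move=> n; by apply: laplace_measurable; exact: cone_compactly_supported.
- move=> n nu; rewrite expeR_ge0/= -expeR0 lee_expeR oppe_le0.
  by apply: integral_ge0 => x _; rewrite lee_fin mulr_ge0// cone_ge0.
move=> nu.
set I := (\int[nu]_x (cone v x))%R.
have IE : (\int[nu]_x (cone v x)%:E = I%:E)%E by rewrite Mp_integral_fineK.
have mcone : measurable_fun setT (fun x : plane R => (cone v x)%:E).
  by apply/measurable_EFinP; apply: continuous_measurable_plane; case: ccb.
have E n : expeR (- \int[nu]_x (n%:R * c * cone v x)%:E)%E = (expR (- (n%:R * c * I)))%:E.
  under eq_integral do rewrite EFinM.
  rewrite ge0_integralZl ?lee_fin//; first by rewrite IE.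
  by move=> x _; rewrite lee_fin cone_ge0.
under eq_fun do rewrite E.
have I0 : 0 <= I by rewrite -lee_fin -IE integral_ge0// => x _; rewrite lee_fin cone_ge0.
apply: cvg_EFin; first by near=> n.
have [H|H] := pselect (null_disc v nu).
  rewrite indicE mem_set//; move: H; rewrite /null_disc /= -cone_integral0 IE => -[->].
  by apply: cvg_near_cst; near=> n; rewrite /= mulr0 oppr0 expR0.
have -> : \1_(null_disc v) nu = 0 :> R by rewrite indicE memNset.
have {}I0 : 0 < I.
  rewrite lt_neqAle I0 andbT; apply/eqP => I00; apply: H.
  by rewrite /null_disc /= -cone_integral0 IE -I00.
have cI : 0 < c * I by exact: mulr_gt0.
(* When [I > 0], [exp y >= 1 + y] at [y = n c I] bounds the exponential by [1 / (n c I)]. *)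
apply: (@squeeze_cvgr _ _ _ _ (cst 0) (fun n : nat => (n%:R * (c * I))^-1)).
- near=> n; rewrite /= expR_ge0 /= expRN lef_pV2 ?posrE ?expR_gt0//.
    rewrite mulrA (le_trans _ (expR_ge1Dx _))// lerDr//.
  by rewrite mulr_gt0// ltr0n; near: n; exact: nbhs_infty_gt.
- exact: cvg_cst.
- have C0 : (n%:R : R)^-1 @[n --> \oo] --> (0 : R).
    apply/gtr0_cvgV0; last exact: cvgr_idn.
    by near=> n; rewrite ltr0n; near: n; exact: nbhs_infty_gt.
  under eq_fun do rewrite invfM.
  have C1 : (n%:R : R)^-1 / (c * I) @[n --> \oo] --> (0 : R) / (c * I).
    by apply: cvgM; [|exact: cvg_cst].
  by rewrite mul0r in C1.
Unshelve. all: by end_near. Qed.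

End transition.

(** * Change of scale and sections for planar Lebesgue measure *)

Section planar_lebesgue.
Context {R : realType}.
Implicit Types (f : R * R -> R) (c : R).

Lemma integral_scale (g : R -> R) c : 0 < c -> continuous g ->
  (forall x, 0 <= g x) ->
  (\int[lebesgue_measure]_x (g x)%:E =
   \int[lebesgue_measure]_x (c * g (c * x))%:E)%E.
Proof.
move=> c0 cg g0.
have dF x : is_derive x (1 : R) (fun x : R => c * x) c.
  by apply: is_derive_eq; rewrite /GRing.scale /= mulr1.
have DF : derive1 (fun x : R => c * x) = cst c.
  by apply/funext => x; rewrite derive1E; exact: (derive_val (is_derive := dF x)).
rewrite (@increasing_ge0_integration_by_substitutionT _ (fun x => c * x))//.
- by apply: eq_integral => x _; rewrite /= DF mulrC.
- by move=> x y xy; rewrite ltr_pM2l.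
- by rewrite DF => x; exact: cvg_cst.
- by rewrite DF; exact: is_cvg_cst.
- by rewrite DF; exact: is_cvg_cst.
- by apply: gt0_cvgMrNy => //; exact: cvg_id.
- by apply: gt0_cvgMry => //; exact: cvg_id.
Qed.

Lemma continuous_pair (h : R -> R * R) : continuous (fst \o h) ->
  continuous (snd \o h) -> continuous h.
Proof.
move=> c1 c2 x.
have H : (fst \o h) y @[y --> x] --> (h x).1 by exact: c1.
have H' : (snd \o h) y @[y --> x] --> (h x).2 by exact: c2.
have : ((h y).1, (h y).2) @[y --> x] --> ((h x).1, (h x).2).
  exact: (cvg_pair H H').
rewrite -surjective_pairing.
by under eq_fun do rewrite -surjective_pairing.
Qed.

Lemma leb2_tonelli f : continuous f -> (forall x, 0 <= f x) ->
  (\int[leb2]_x (f x)%:E =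
   \int[lebesgue_measure]_x \int[lebesgue_measure]_y (f (x, y))%:E)%E.
Proof.
move=> cf f0; rewrite /leb2 fubini_tonelli1//.
by apply/measurable_EFinP; exact: continuous_measurable_plane.
Qed.

Lemma leb2_tonelli_swap f : continuous f -> (forall x, 0 <= f x) ->
  (\int[leb2]_x (f x)%:E =
   \int[lebesgue_measure]_y \int[lebesgue_measure]_x (f (x, y))%:E)%E.
Proof.
move=> cf f0; rewrite /leb2 fubini_tonelli2//.
by apply/measurable_EFinP; exact: continuous_measurable_plane.
Qed.

(** The coordinates are scaled one at a time: each is made the inner variable by Tonelli and
    contributes one factor [c]. *)
Lemma leb2_integral_scale f c : 0 < c -> continuous f -> (forall x, 0 <= f x) ->
  (\int[leb2]_x (f x)%:E = \int[leb2]_x (c ^+ 2 * f (c *: x))%:E)%E.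
Proof.
move=> c0 cf f0.
have cg : continuous (fun x : R * R => c * f (x.1, c * x.2)).
  move=> x; apply: cvgM; first exact: cvg_cst.
  have C : (y.1, c * y.2) @[y --> x] --> (x.1, c * x.2).
    have C1 : y.1 @[y --> x] --> x.1 by exact: cvg_fst.
    have C2 : c * y.2 @[y --> x] --> c * x.2 by apply: cvgM; [exact: cvg_cst|exact: cvg_snd].
    exact: (cvg_pair C1 C2).
  exact: (cvg_comp _ _ C (cf _)).
have ch : continuous (fun x : R * R => c ^+ 2 * f (c *: x)).
  move=> x; apply: cvgM; first exact: cvg_cst.
  apply: (@cvg_comp _ _ _ (fun y : R * R => c *: y) f).
    exact: scaler_continuous.
  exact: cf.
have g0 x : 0 <= c * f (x.1, c * x.2) by rewrite mulr_ge0// ltW.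
have h0 x : 0 <= c ^+ 2 * f (c *: x) by rewrite mulr_ge0// sqr_ge0.
rewrite (leb2_tonelli cf f0) (leb2_tonelli_swap ch h0).
transitivity (\int[leb2]_x (c * f (x.1, c * x.2)%R)%:E)%E.
  rewrite (leb2_tonelli cg g0).
  apply: eq_integral => x _; apply: (@integral_scale (fun y => f (x, y)) c) => //.
  move=> y; apply: (@continuous_comp _ _ _ (fun y => (x, y)) f); last exact: cf.
  by apply: continuous_pair => z; [exact: cvg_cst|exact: cvg_id].
rewrite (leb2_tonelli_swap cg g0).
apply: eq_integral => y _ /=.
rewrite (@integral_scale (fun x => c * f (x, c * y)) c c0).
- by apply: eq_integral => x _; rewrite mulrA.
- move=> x; apply: cvgM; first exact: cvg_cst.
  apply: (@continuous_comp _ _ _ (fun x => (x, c * y)) f); last exact: cf.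
  by apply: continuous_pair => z; [exact: cvg_id|exact: cvg_cst].
- by move=> x; rewrite mulr_ge0// ltW.
Qed.

(** One formula serves for all [x]: when [|x| >= r] the square root is 0 and the interval is empty,
    like the section. *)
Lemma xsection_disc (r x : R) : 0 <= r -> xsection (disc r) x =
  `](- Num.sqrt (r ^+ 2 - x ^+ 2)), (Num.sqrt (r ^+ 2 - x ^+ 2))[%classic.
Proof.
move=> r0; apply/seteqP; split => y; rewrite /xsection /= inE /disc /enorm /= in_itv /= -ltr_norml => H.
  have {}H : x ^+ 2 + y ^+ 2 < r ^+ 2.
    rewrite -(@sqr_sqrtr _ (_ + _)) ?addr_ge0 ?sqr_ge0//.
    by rewrite ltr_sqr ?nnegrE ?sqrtr_ge0.
  rewrite -ltr_sqr ?nnegrE ?sqrtr_ge0// sqr_sqrtr ?real_normK ?num_real//; last first.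
    by have := sqr_ge0 y; lra.
  by lra.
have H1 : 0 < Num.sqrt (r ^+ 2 - x ^+ 2) by exact: le_lt_trans H.
rewrite sqrtr_gt0 in H1.
rewrite -ltr_sqr ?nnegrE ?sqrtr_ge0// sqr_sqrtr ?addr_ge0 ?sqr_ge0//.
have : `|y| ^+ 2 < Num.sqrt (r ^+ 2 - x ^+ 2) ^+ 2 by rewrite ltr_sqr ?nnegrE ?sqrtr_ge0.
rewrite sqr_sqrtr ?(ltW H1)// real_normK ?num_real//.
lra.
Qed.

Lemma integral_cos_sqr : (\int[lebesgue_measure]_(x in `[(- (pi / 2))%R, (pi / 2)%R])
  (2 * cos x ^+ 2 : R)%:E = pi%:E)%E.
Proof.
have pi0 := pi_gt0 R.
have dF (x : R) : is_derive x (1 : R) (fun x : R => x + sin x * cos x) (2 * cos x ^+ 2).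
  apply: is_derive_eq; rewrite /GRing.scale /= !mulrN -!expr2.
  by have := cos2Dsin2 x; lra.
have cF (x : R) : {for x, continuous (fun x : R => x + sin x * cos x)}.
  have := ex_derive (is_derive := dF x).
  by move=> /derivable1_diffP/differentiable_continuous.
rewrite (@continuous_FTC2 _ _ (fun x : R => x + sin x * cos x)).
- rewrite cosN cos_pihalf !mulr0 !addr0 -EFinB; congr EFin; lra.
- lra.
- apply: continuous_subspaceT => x; apply: cvgM; first exact: cvg_cst.
  apply: (@continuous_comp _ _ _ cos (fun y : R => y ^+ 2)); first exact: continuous_cos.
  exact: exprn_continuous.
- split => [x _||].
  + exact: (ex_derive (is_derive := dF x)).
  + by apply: cvg_at_right_filter; exact: cF.
  + by apply: cvg_at_left_filter; exact: cF.
- by move=> x _; rewrite derive1E; exact: (derive_val (is_derive := dF x)).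
Qed.

End planar_lebesgue.

(** * Area of a disc *)

Section disc_area.
Context {R : realType}.
Implicit Types (f : R * R -> R) (c : R).

(** Chord lengths are integrated with the substitution [x = r sin s], which turns the integral into
    [r^2] times [integral_cos_sqr]. *)
Lemma leb2_disc (r : R) : 0 < r -> leb2 (disc r) = (pi * r ^+ 2)%:E.
Proof.
move=> r0.
have pi0 := pi_gt0 R.
pose g (x : R) : R := 2 * Num.sqrt (r ^+ 2 - x ^+ 2).
have cg : continuous g.
  move=> x; apply: cvgM; first exact: cvg_cst.
  apply: (@continuous_comp _ _ _ (fun x : R => r ^+ 2 - x ^+ 2) Num.sqrt).
    by apply: cvgB; [exact: cvg_cst|exact: exprn_continuous].
  exact: sqrt_continuous.
transitivity (\int[lebesgue_measure]_x (g x)%:E)%E.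
  rewrite /leb2 /product_measure1 /=; apply: eq_integral => x _ /=.
  rewrite xsection_disc ?ltW// lebesgue_measure_itv /= lte_fin.
  have s0 := sqrtr_ge0 (r ^+ 2 - x ^+ 2).
  case: ifPn => H; first by rewrite -EFinB /g; congr EFin; ring.
  rewrite /g; have -> : Num.sqrt (r ^+ 2 - x ^+ 2) = 0 by lra.
  by rewrite mulr0.
have -> : (\int[lebesgue_measure]_x (g x)%:E =
  \int[lebesgue_measure]_(x in `[(- r)%R, r]) (g x)%:E)%E.
  rewrite [RHS]integral_mkcond; apply: eq_integral => x _.
  rewrite patchE; case: ifPn => //; rewrite notin_setE /= in_itv /= => H.
  rewrite /g ler0_sqrtr ?mulr0// subr_le0 leNgt; apply/negP => H2; apply: H.
  by rewrite -ler_norml -ler_sqr ?nnegrE ?(ltW r0)// real_normK ?num_real// ltW.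
have dF (x : R) : is_derive x (1 : R) (fun x : R => r * sin x) (r * cos x).
  by apply: is_derive_eq; rewrite /GRing.scale /=; ring.
have DF : derive1 (fun x : R => r * sin x) = fun x : R => r * cos x.
  by apply/funext => x; rewrite derive1E; exact: (derive_val (is_derive := dF x)).
have cF (x : R) : {for x, continuous (fun x : R => r * sin x)}.
  have := ex_derive (is_derive := dF x).
  by move=> /derivable1_diffP/differentiable_continuous.
have cC : continuous (fun x : R => r * cos x).
  by move=> x; apply: cvgM; [exact: cvg_cst|exact: continuous_cos].
have := @integration_by_substitution_increasing R (fun x => r * sin x) g (- (pi / 2)) (pi / 2).
rewrite DF sinN sin_pihalf mulrN !mulr1 => ->.
- rewrite EFinM -integral_cos_sqr muleC -ge0_integralZl//.
  + apply: eq_integral => x; rewrite inE /= in_itv /= => xpi.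
    rewrite /g /= -EFinM; congr EFin.
    have cx : 0 <= cos x by exact: cos_ge0_pihalf.
    transitivity (2 * Num.sqrt (r ^+ 2 - (r * sin x) ^+ 2) * (r * cos x)); first by [].
    have -> : r ^+ 2 - (r * sin x) ^+ 2 = (r * cos x) ^+ 2.
      by rewrite !exprMn cos2sin2; ring.
    rewrite sqrtr_sqr ger0_norm ?mulr_ge0 ?(ltW r0)//; ring.
  + apply/measurable_EFinP; apply: measurable_funTS.
    apply: continuous_measurable_fun => x; apply: cvgM; first exact: cvg_cst.
    apply: (@continuous_comp _ _ _ cos (fun y : R => y ^+ 2)); first exact: continuous_cos.
    exact: exprn_continuous.
  + by move=> x _; rewrite lee_fin mulr_ge0// sqr_ge0.
  + by rewrite lee_fin sqr_ge0.
- lra.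
- move=> x y; rewrite !in_itv /= => xI yI xy; rewrite ltr_pM2l//.
  by rewrite ltr_sin// in_itv.
- by move=> x _; exact: cC.
- by apply: cvgP; apply: cvg_at_right_filter; exact: cC.
- by apply: cvgP; apply: cvg_at_left_filter; exact: cC.
- split => [x _||].
  + by case: (dF x).
  + have := cF (- (pi / 2)); rewrite /prop_for /continuous_at sinN sin_pihalf.
    by move/cvg_at_right_filter.
  + have := cF (pi / 2); rewrite /prop_for /continuous_at sin_pihalf.
    by move/cvg_at_left_filter.
- exact: continuous_subspaceT.
Qed.

End disc_area.

(** * An integrable majorant with product form *)

Section oneDsqr_plane.
Context {R : realType}.
Implicit Types (f : R * R -> R) (c : R).

(** It decays only like [|x|^-2] along the axes, yet dominates a multiple of [|x|^-4] away from the
    origin and has an integral that factors into two arctangent integrals. *)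
Definition oneDsqr_inv2 (x : R * R) : R := (oneDsqr x.1)^-1 * (oneDsqr x.2)^-1.

Lemma continuous_oneDsqr_inv2 : continuous oneDsqr_inv2.
Proof.
move=> x; apply: cvgM.
  by apply: (@continuous_comp _ _ _ fst (fun y : R => (oneDsqr y)^-1));
    [exact: cvg_fst|exact: continuous_oneDsqrV].
by apply: (@continuous_comp _ _ _ snd (fun y : R => (oneDsqr y)^-1));
  [exact: cvg_snd|exact: continuous_oneDsqrV].
Qed.

Lemma oneDsqr_inv2_ge0 x : 0 <= oneDsqr_inv2 x.
Proof. by rewrite mulr_ge0// invr_ge0 addr_ge0// sqr_ge0. Qed.

Lemma integral_oneDsqr_inv :
  (\int[lebesgue_measure]_x ((oneDsqr x)^-1 : R)%:E = pi%:E)%E.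
Proof.
rewrite (@ge0_symfun_integralT _ (fun x : R => (oneDsqr x)^-1)).
- have -> : [set x : R | (0 <= x)%R] = `[0%R, +oo[%classic.
    by apply/seteqP; split => x /=; rewrite in_itv /= andbT.
  by rewrite integral0y_oneDsqr -EFinM; congr EFin; lra.
- by move=> x; rewrite invr_ge0 addr_ge0// sqr_ge0.
- exact: continuous_oneDsqrV.
- by move=> x /=; rewrite /oneDsqr sqrrN.
Qed.

Lemma integral_oneDsqr_inv2 : (\int[leb2]_x (oneDsqr_inv2 x)%:E = (pi ^+ 2)%:E)%E.
Proof.
rewrite leb2_tonelli; [|exact: continuous_oneDsqr_inv2|exact: oneDsqr_inv2_ge0].
have mV : measurable_fun setT (fun x : R => ((oneDsqr x)^-1 : R)%:E).
  apply/measurable_EFinP; apply: continuous_measurable_fun; exact: continuous_oneDsqrV.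
have V0 (x : R) : (0 <= ((oneDsqr x)^-1 : R)%:E)%E.
  by rewrite lee_fin invr_ge0 addr_ge0// sqr_ge0.
under eq_integral => x _.
  rewrite /oneDsqr_inv2 /=; under eq_integral do rewrite EFinM.
  rewrite ge0_integralZl// integral_oneDsqr_inv muleC.
  over.
rewrite ge0_integralZl ?lee_fin ?pi_ge0// integral_oneDsqr_inv -EFinM expr2//.
Qed.

End oneDsqr_plane.

(** * Inequalities for the Euclidean norm and for cones *)

Section plane_geometry.
Context {R : realType}.
Implicit Types x y : R * R.

(** The reverse triangle inequality, squared. It follows from Cauchy-Schwarz, whose defect is the
    square of the determinant of [x] and [y]. *)
Lemma enorm_sub_sqdist x y : (enorm x - enorm y) ^+ 2 <= sqdist y x.
Proof.
have x0 := enorm_ge0 x; have y0 := enorm_ge0 y.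
have sx := sqr_enorm x; have sy := sqr_enorm y.
have CS : x.1 * y.1 + x.2 * y.2 <= enorm x * enorm y.
  have [H|/ltW H] := leP (x.1 * y.1 + x.2 * y.2) 0.
    by apply: (le_trans H); rewrite mulr_ge0.
  rewrite -ler_sqr ?nnegrE ?mulr_ge0// exprMn sx sy -subr_ge0.
  rewrite (_ : _ - _ = (x.1 * y.2 - x.2 * y.1) ^+ 2) ?sqr_ge0//; ring.
rewrite /sqdist; nra.
Qed.

Lemma cone_scale (c r : R) x : 0 < c -> cone (r * c) (c *: x) = c * cone r x.
Proof.
move=> c0; rewrite /cone; have -> : enorm (c *: x) = c * enorm x.
  rewrite /enorm /= /GRing.scale /= !exprMn -mulrDr sqrtrM ?sqr_ge0//.
  by rewrite sqrtr_sqr gtr0_norm.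
by rewrite maxr_pMr ?(ltW c0)// mulr0 mulrBr (mulrC r).
Qed.

Lemma cone_eq0 (r : R) x : r <= enorm x -> cone r x = 0.
Proof. by move=> H; rewrite /cone max_l// subr_le0. Qed.

Lemma cone_ge (r : R) x : r - enorm x <= cone r x.
Proof. by rewrite /cone le_max lexx orbT. Qed.

Lemma cone_le (r : R) x : cone r x <= `|r|.
Proof.
by rewrite /cone ge_max normr_ge0/= lerBlDr ler_wpDr ?enorm_ge0// ler_norm.
Qed.

(** [(1 + x1^2) (1 + x2^2) <= (1 + |x|^2)^2], and [1 <= |x|^2 / rho^2] absorbs the remaining 1. *)
Lemma oneDsqr_inv2_tail (rho : R) x : 0 < rho -> rho <= enorm x ->
  (enorm x ^+ 4)^-1 <= (1 + (rho ^+ 2)^-1) ^+ 2 * oneDsqr_inv2 x.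
Proof.
move=> rho0 rx; have x0 : 0 < enorm x by exact: lt_le_trans rx.
have r20 : 0 < rho ^+ 2 by exact: exprn_gt0.
rewrite /oneDsqr_inv2 /oneDsqr -invfM.
have D0 : 0 < (1 + x.1 ^+ 2) * (1 + x.2 ^+ 2).
  by rewrite mulr_gt0// ltr_pwDl// sqr_ge0.
rewrite ler_pdivlMr// mulrC ler_pdivrMr ?exprn_gt0//.
have H1 : 1 <= (rho ^+ 2)^-1 * enorm x ^+ 2.
  by rewrite mulrC ler_pdivlMr// mul1r ler_sqr ?nnegrE// ltW.
have a1 := sqr_ge0 x.1; have a2 := sqr_ge0 x.2.
have H2 : 1 + enorm x ^+ 2 <= (1 + (rho ^+ 2)^-1) * enorm x ^+ 2 by lra.
apply: (@le_trans _ _ ((1 + enorm x ^+ 2) ^+ 2)).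
  by rewrite sqr_enorm; nra.
rewrite (_ : (_ + _) ^+ 2 * _ = ((1 + (rho ^+ 2)^-1) * enorm x ^+ 2) ^+ 2); last first.
  by rewrite exprMn -exprM.
have P1 : 0 <= 1 + enorm x ^+ 2 by rewrite addr_ge0// sqr_ge0.
by rewrite ler_sqr ?nnegrE// (le_trans P1).
Qed.

End plane_geometry.

(** * Bounds for the solutions started from cones *)

Section cone_solution_bounds.
Context {R : realType} {p : R}.
Variable Q : R -> R.-pker (Mp p) ~> (Mp p).
Hypothesis hQ : sbm_transition Q.
Hypothesis p0 : 0 < p.
Implicit Types (r k e L : R) (x : R * R).

Let sol r k : 0 <= k -> positive_solution (fun x => k * cone r x) (cone_solution r k).
Proof. by move=> k0; apply: (solution_positive hQ); exact: cone_admissible. Qed.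

Lemma cone_solution_ge0 r k t x : 0 <= k -> 0 <= t -> 0 <= cone_solution r k t x.
Proof. by by move=> k0 t0; apply: (solution_ge0 hQ) => //; exact: cone_admissible. Qed.

(** The datum is bounded by [k |r|] on the whole plane, so [K] in [solution_upper_bound] may be
    arbitrarily large: [c / (1 + c) < 1] remains and [800 / K^2] is made smaller than [e]. *)
Lemma cone_solution_le1 r k x : 0 <= k -> cone_solution r k 1 x <= 1.
Proof.
move=> k0; apply/ler_addgt0Pr => e e0.
set c := k * `|r|.
have c0 : 0 <= c by rewrite mulr_ge0.
have M0 : 0 < 800 :> R by rewrite ltr0n.
set M : R := 800 in M0.
have H : 0 < M / e by rewrite divr_gt0.
have K0 : 0 < 1 + M / e by lra.
apply: (le_trans (@solution_upper_bound _ _ _ x (1 + M / e) c (sol r k0) K0 c0 _)).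
  by move=> y _; rewrite ler_wpM2l// cone_le.
rewrite -/M; apply: lerD.
  by rewrite ler_pdivrMr ?mul1r ?lerDr// ltr_pwDl.
rewrite ler_pdivrMr ?exprn_gt0// -ler_pdivrMl// mulrC; nra.
Qed.

(** The datum vanishes on the ball of radius [|x| - r] about [x], so [solution_upper_bound] applies
    with [c = 0]; beyond [(1 + e) r] that radius is at least [|x| e / (1 + e)]. *)
Lemma cone_solution_tail r k e x : 0 < r -> 0 <= k -> 0 < e ->
  (1 + e) * r <= enorm x ->
  cone_solution r k 1 x <= 800 * ((1 + e) / e) ^+ 4 *
    (1 + (((1 + e) * r) ^+ 2)^-1) ^+ 2 * oneDsqr_inv2 x.
Proof.
move=> r0 k0 e0 rx.
have e1 : 0 < 1 + e by lra.
have er : 0 < (1 + e) * r by exact: mulr_gt0.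
have x0 : 0 < enorm x by exact: lt_le_trans rx.
set a := enorm x in rx x0 *.
have ar : a * (e / (1 + e)) <= a - r.
  rewrite -subr_ge0 (_ : _ - _ = a / (1 + e) - r); last by field; rewrite gt_eqF.
  by rewrite subr_ge0 ler_pdivlMr// mulrC.
have ar0 : 0 < a * (e / (1 + e)) by rewrite mulr_gt0// divr_gt0.
have ar1 : 0 < a - r by exact: lt_le_trans ar.
have K0 : 0 < (a - r) ^+ 2 by exact: exprn_gt0.
apply: (le_trans (@solution_upper_bound _ _ _ x _ 0 (sol r k0) K0 (lexx 0) _)).
  move=> y yx; rewrite cone_eq0 ?mulr0// leNgt; apply/negP => yr.
  have := le_trans (enorm_sub_sqdist x y) yx; rewrite -/a.
  rewrite ler_sqr ?nnegrE ?(ltW ar1)//; last by lra.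
  lra.
have : 0 <= 800 :> R by rewrite ler0n.
move: (800 : R) => M M0.
rewrite mul0r add0r -exprM -(mulrA (M * _)) -(mulrA M) ler_wpM2l//.
apply: (@le_trans _ _ (((1 + e) / e) ^+ 4 * (a ^+ 4)^-1)).
  rewrite -!exprVn -exprMn ler_pXn2r ?nnegrE ?invr_ge0 ?(ltW ar1)//.
    rewrite (_ : _ * _ = (a * (e / (1 + e)))^-1).
      by rewrite lef_pV2 ?posrE.
    by field; rewrite !gt_eqF.
  by rewrite mulr_ge0 ?divr_ge0 ?invr_ge0 ?ltW.
rewrite ler_wpM2l ?exprn_ge0 ?divr_ge0 ?(ltW e0) ?(ltW e1)//.
exact: oneDsqr_inv2_tail.
Qed.

(** On the ball of radius [L] about [x] the cone is at least [r - L - |x|], which gives the constant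
    [c] of [solution_lower_bound]. *)
Lemma cone_solution_lower r k L x : 0 <= k -> 0 < L -> enorm x < r - L ->
  expR (- (4 / L ^+ 2)) * (k * (r - L - enorm x) / (1 + k * (r - L - enorm x)))
  <= cone_solution r k 1 x.
Proof.
move=> k0 L0 xr; have m0 : 0 < r - L - enorm x by rewrite subr_gt0.
have c0 : 0 <= k * (r - L - enorm x) by rewrite mulr_ge0// ltW.
apply: (solution_lower_bound (sol r k0)) => //; first exact: exprn_gt0.
move=> y yx; rewrite ler_wpM2l// (le_trans _ (cone_ge _ _))//.
rewrite -addrA lerD2l.
have : (enorm y - enorm x) ^+ 2 <= L ^+ 2.
  by apply: le_trans (enorm_sub_sqdist y x) _; rewrite /sqdist in yx *; nra.
have [H|H] := leP (enorm y) (enorm x); first by move=> _; lra.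
rewrite ler_sqr ?nnegrE ?subr_ge0 ?(ltW L0) ?(ltW H)//; lra.
Qed.

(** The slope is multiplied by [c^3] with [c = sqrt t]: two factors come from the scaling of
    solutions, one from the homogeneity of the cone. Uniqueness identifies the two solutions. *)
Lemma cone_solution_scale r k t x : 0 < t -> 0 <= k ->
  cone_solution (r * Num.sqrt t) k t (Num.sqrt t *: x) =
  t^-1 * cone_solution r (k * Num.sqrt t ^+ 3) 1 x.
Proof.
move=> t0 k0; set c := Num.sqrt t.
have c0 : 0 < c by rewrite sqrtr_gt0.
have ct : c ^+ 2 = t by rewrite sqr_sqrtr// ltW.
have := positive_solution_scale (sol (r * c) k0) c0.
have -> : (fun x => c ^+ 2 * (k * cone (r * c) (c *: x))) =
    (fun x => k * c ^+ 3 * cone r x).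
  by apply/funext => y; rewrite cone_scale//; ring.
have kc : 0 <= k * c ^+ 3 by rewrite mulr_ge0// exprn_ge0// ltW.
move=> /(solutionE hQ x (cone_admissible r p0 kc)) => /(_ 1 ler01).
rewrite mulr1 ct /cone_solution => <-.
by rewrite mulKf// gt_eqF.
Qed.

End cone_solution_bounds.

Lemma emeasurable_prod d (T : measurableType d) (R : realType) (I : Type)
    (s : seq I) (Q : pred I) (f : I -> T -> \bar R) :
  (forall i, measurable_fun setT (f i)) ->
  measurable_fun setT (fun x => \prod_(i <- s | Q i) f i x)%E.
Proof.
move=> mf; elim: s => [|i s IH].
  by under eq_fun do rewrite big_nil; exact: measurable_cst.
under eq_fun do rewrite big_cons.
by case: (Q i) => //; exact: emeasurable_funM.
Qed.

(** * From independent events to products of expectations *)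

Section independence.
Context {d : measure_display} {Omega : measurableType d} {R : realType}.
Variable P : probability Omega R.
Context {n : nat}.
Variable Z : 'I_n -> Omega -> \bar R.
Hypothesis mZ : forall i, measurable_fun setT (Z i).
Hypothesis indep : forall A : 'I_n -> set (\bar R), (forall i, measurable (A i)) ->
  P (\bigcap_i [set w | A i (Z i w)]) = (\prod_(i < n) P [set w | A i (Z i w)])%E.
Variables (a : 'I_n -> nat -> R) (S : 'I_n -> nat -> set (\bar R)).
Hypothesis a0 : forall i k, 0 <= a i k.
Hypothesis mS : forall i k, measurable (S i k).

(** Weighted sums of indicators are general enough for [count_laplace], and their expectations
    follow from probabilities of events by countable additivity alone. *)
Definition countable_step (i : 'I_n) (x : \bar R) : \bar R :=
  (\sum_(k <oo) (a i k)%:E * (\1_(S i k) x)%:E)%E.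

Hypothesis step_le1 : forall i x, (countable_step i x <= 1)%E.

Lemma countable_step_ge0 i x : (0 <= countable_step i x)%E.
Proof.
by apply: nneseries_ge0 => k _ _; rewrite mule_ge0// lee_fin.
Qed.

Lemma measurable_indic_comp (A : set (\bar R)) i : measurable A ->
  measurable_fun setT (fun w => (\1_A (Z i w))%:E : \bar R).
Proof.
move=> mA; apply/measurable_EFinP; have mI : measurable_fun setT (\1_A : \bar R -> R) by exact: measurable_indic.
exact: (measurableT_comp mI (mZ i)).
Qed.

Lemma measurable_countable_step i :
  measurable_fun setT (fun w => countable_step i (Z i w)).
Proof.
apply: ge0_emeasurable_sum => [k x _ _|k _].
  by rewrite mule_ge0// lee_fin.
by apply: measurable_funeM; exact: measurable_indic_comp.
Qed.

(* The first [j] events [Z i \in A i] are replaced by the random variables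
   [countable_step i (Z i)], one at a time. *)
Let F (j : nat) (A : 'I_n -> set (\bar R)) (i : 'I_n) (w : Omega) : \bar R :=
  if (i < j)%N then countable_step i (Z i w) else (\1_(A i) (Z i w))%:E.

Let F_ge0 j A i w : (0 <= F j A i w)%E.
Proof. by rewrite /F; case: ifPn => // _; exact: countable_step_ge0. Qed.

Let F_le1 j A i w : (F j A i w <= 1)%E.
Proof.
by rewrite /F; case: ifPn => // _; rewrite lee_fin indicE; case: (_ \in _).
Qed.

Let mF j A i : (forall i, measurable (A i)) -> measurable_fun setT (F j A i).
Proof.
move=> mA; rewrite /F; case: (i < j)%N; first exact: measurable_countable_step.
exact: measurable_indic_comp.
Qed.

Let mprod j A (Q : pred 'I_n) : (forall i, measurable (A i)) ->
  measurable_fun setT (fun w => \prod_(i < n | Q i) F j A i w)%E.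
Proof. by move=> mA; apply: emeasurable_prod => i; exact: mF. Qed.

Let intF_fin j A i : (forall i, measurable (A i)) ->
  (\int[P]_w F j A i w)%E \is a fin_num.
Proof.
move=> mA; rewrite ge0_fin_numE; last exact: integral_ge0.
apply: (@le_lt_trans _ _ (\int[P]_w (cst 1%E w))%E).
  apply: ge0_le_integral => //; exact: mF.
rewrite integral_cst// mul1e.
exact: le_lt_trans (probability_le1 P measurableT) (ltry _).
Qed.

Let prod_step j : (j <= n)%N -> forall A, (forall i, measurable (A i)) ->
  (\int[P]_w \prod_(i < n) F j A i w = \prod_(i < n) \int[P]_w F j A i w)%E.
Proof.
elim: j => [_ A mA|j IH jn A mA].
  have mZA i : measurable [set w | A i (Z i w)].
    by rewrite -[X in measurable X]setTI; apply: (mZ i) => //; exact: mA.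
  have -> : (\prod_(i < n) \int[P]_w F 0 A i w = \prod_(i < n) P [set w | A i (Z i w)])%E.
    apply: eq_bigr => i _; rewrite /F ltn0.
    transitivity (\int[P]_w (\1_[set w | A i (Z i w)] w)%:E)%E; last first.
      by rewrite integral_indic// setIT.
    by apply: eq_integral => w _; rewrite !indicE.
  rewrite -indep//; set E := \bigcap_i _.
  transitivity (\int[P]_w (\1_E w)%:E)%E; last first.
    rewrite integral_indic// ?setIT//.
    by apply: fin_bigcap_measurable => //; exact: finite_finset.
  apply: eq_integral => w _; rewrite /F.
  transitivity (\prod_(i < n) (\1_(A i) (Z i w) : R)%:E)%E; first exact: eq_bigr.
  rewrite prodEFin; congr EFin; rewrite indicE.
  case: (boolP (w \in _)) => [|/negP H].
    rewrite inE => H; apply: big1 => i _; rewrite indicE mem_set//; exact: H.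
  apply/eqP; rewrite prodf_seq_eq0; apply/hasP.
  have [i Hi] : exists i, ~ A i (Z i w).
    by apply/existsNP => H2; apply: H; rewrite inE => i _; exact: H2.
  by exists i; rewrite ?mem_index_enum//= indicE memNset.
have {}IH := IH (ltnW jn).
pose i0 := Ordinal jn.
(* By linearity the factor of index [i0] is a series over [k]; for each [k] it is again an
   indicator, and the induction hypothesis applies to the family with [S i0 k] in place of
   [A i0]. *)
pose A' k i := if i == i0 then S i0 k else A i.
have mA' k i : measurable (A' k i) by rewrite /A'; case: ifP.
have FA k i w : i != i0 -> F j.+1 A i w = F j (A' k) i w.
  move=> ii0; rewrite /F /A' (negbTE ii0) ltnS leq_eqVlt.
  by rewrite -[j]/(nat_of_ord i0) val_eqE (negbTE ii0).
have F0 w : F j.+1 A i0 w = countable_step i0 (Z i0 w) by rewrite /F ltnSn.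
have F0' k w : F j (A' k) i0 w = (\1_(S i0 k) (Z i0 w))%:E.
  by rewrite /F ltnn /A' eqxx.
rewrite [RHS](bigD1 i0)//=.
set c := (\prod_(i < n | i != i0) _)%E.
(* All factors lie in [0, 1], so the product of the others is a finite scalar and can be taken out
   of the series. *)
have cfin : c \is a fin_num by apply: prode_fin_num => i _; exact: intF_fin.
have IHk k : (\int[P]_w ((\1_(S i0 k) (Z i0 w))%:E * \prod_(i < n | i != i0) F j.+1 A i w) =
    (\int[P]_w (\1_(S i0 k) (Z i0 w))%:E) * c)%E.
  transitivity (\int[P]_w \prod_(i < n) F j (A' k) i w)%E.
    apply: eq_integral => w _; rewrite [RHS](bigD1 i0)//= F0'; congr (_ * _)%E.
    by apply: eq_bigr => i ii0; exact: FA.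
  rewrite IH// (bigD1 i0)//=; congr (_ * _)%E.
    by apply: eq_integral => w _; exact: F0'.
  by apply: eq_bigr => i ii0; apply: eq_integral => w _; rewrite (FA k).
have prod0 w : (0 <= \prod_(i < n | i != i0) F j.+1 A i w)%E by apply: prode_ge0.
have prodfin w : (\prod_(i < n | i != i0) F j.+1 A i w)%E \is a fin_num.
  apply: prode_fin_num => i _; rewrite ge0_fin_numE//.
  exact: le_lt_trans (F_le1 _ _ _ _) (ltry _).
have mI k : measurable_fun setT (fun w => (\1_(S i0 k) (Z i0 w))%:E : \bar R).
  exact: measurable_indic_comp.
transitivity (\int[P]_w \sum_(k <oo) ((a i0 k)%:E *
    ((\1_(S i0 k) (Z i0 w))%:E * \prod_(i < n | i != i0) F j.+1 A i w)))%E.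
  apply: eq_integral => w _; rewrite (bigD1 i0)//= F0.
  rewrite -(fineK (prodfin w)) muleC -nneseriesZl.
    by apply: eq_eseriesr => k _; rewrite muleCA; congr (_ * _)%E; exact: muleC.
  by move=> k _; rewrite mule_ge0// lee_fin.
rewrite integral_nneseries//; last 2 first.
  - by move=> k; apply: measurable_funeM; apply: emeasurable_funM => //; exact: mprod.
  - by move=> k w _; rewrite mule_ge0 ?lee_fin// mule_ge0// lee_fin.
under eq_eseriesr => k _.
  rewrite ge0_integralZl ?lee_fin//; last 2 first.
  - by apply: emeasurable_funM => //; exact: mprod.
  - by move=> w _; rewrite mule_ge0// lee_fin.
  rewrite IHk -(fineK cfin) muleA muleC.
  over.
rewrite nneseriesZl; last first.
  by move=> k _; rewrite mule_ge0 ?lee_fin// integral_ge0.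
rewrite fineK// muleC; congr (_ * _)%E.
under [RHS]eq_integral do rewrite F0 /countable_step.
rewrite integral_nneseries//; last 2 first.
  - by move=> k; apply: measurable_funeM.
  - by move=> k w _; rewrite mule_ge0// lee_fin.
by apply: eq_eseriesr => k _; rewrite ge0_integralZl ?lee_fin.
Qed.

Lemma expectation_prod_countable_step :
  (\int[P]_w \prod_(i < n) countable_step i (Z i w) =
   \prod_(i < n) \int[P]_w countable_step i (Z i w))%E.
Proof.
have := @prod_step n (leqnn n) (fun=> setT) (fun=> measurableT).
rewrite /F.
under eq_integral do under eq_bigr do rewrite ltn_ord.
move=> ->; apply: eq_bigr => i _; by under eq_integral do rewrite ltn_ord.
Qed.

End independence.

(** * Laplace transform of a Poisson variable *)

Section poisson_laplace.
Context {R : realType}.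

Lemma nneseries_expR (x : R) : 0 <= x ->
  (\sum_(k <oo) (x ^+ k / k`!%:R)%:E = (expR x)%:E)%E.
Proof.
move=> x0; rewrite /expR -EFin_lim; last exact: is_cvg_series_exp_coeff.
by apply/congr_lim/funext => n /=; rewrite /series /= -sumEFin big_mkord.
Qed.

(** Equal to [exp(- c x)] when [x] is a natural number and to 0 otherwise. A Poisson count is almost
    surely a natural number, so the difference is invisible to expectations. *)
Definition count_laplace (c : R) (x : \bar R) : \bar R :=
  (\sum_(k <oo) (expR (- (c * k%:R)))%:E * (\1_[set (k%:R : R)%:E] x)%:E)%E.

Lemma count_laplace_nat c k : count_laplace c k%:R%:E = expeR (- (c%:E * k%:R%:E)).
Proof.
rewrite /count_laplace (@nneseriesD1 _ _ k)//.
rewrite indicE mem_set// mule1 eseries0 ?adde0//.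
move=> j _ /= jk; rewrite indicE memNset ?mule0//= => -[] /eqP.
by rewrite eqr_nat eq_sym (negbTE jk).
Qed.

Lemma count_laplace_le1 c x : 0 <= c -> (count_laplace c x <= 1)%E.
Proof.
move=> c0; have [[k ->]|H] := pselect (exists k : nat, x = k%:R%:E).
  rewrite count_laplace_nat -expeR0 lee_expeR oppe_le0 mule_ge0 ?lee_fin//.
rewrite /count_laplace eseries0// => k _ _.
by rewrite indicE memNset ?mule0// => Hk; apply: H; exists k.
Qed.

Context {d : measure_display} {Omega : measurableType d}.
Variable P : probability Omega R.
Variables (Z : Omega -> \bar R) (m : R).
Hypothesis mZ : measurable_fun setT Z.
Hypothesis m0 : 0 <= m.
Hypothesis PZ : forall k : nat,
  P [set w | Z w = k%:R%:E] = (m ^+ k / k`!%:R * expR (- m))%:E.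

Let mset (k : nat) : measurable [set w | Z w = k%:R%:E].
Proof.
by have := mZ measurableT (emeasurable_set1 (k%:R : R)%:E); rewrite setTI.
Qed.

(** The Poisson weights sum to 1, so the event that the value is a natural number has full
    probability. *)
Lemma poisson_integer : {ae P, forall w, exists k : nat, Z w = k%:R%:E}.
Proof.
set U := \bigcup_k [set w | Z w = k%:R%:E].
have mU : measurable U by exact: bigcup_measurable.
have tU : trivIset setT (fun k : nat => [set w | Z w = k%:R%:E]).
  by move=> i j _ _ [w [/= -> []]] /eqP; rewrite eqr_nat => /eqP.
have PU : P U = 1%E.
  rewrite (measure_semi_bigcup P mset tU mU).
  rewrite (@eq_eseriesr _ _ (fun k => (expR (- m))%:E * (m ^+ k / k`!%:R)%:E)%E).
    rewrite nneseriesZl; last by move=> k _; rewrite lee_fin divr_ge0// exprn_ge0.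
    by rewrite nneseries_expR// -EFinM -expRD addNr expR0.
  by move=> k _; rewrite [LHS](PZ k) -EFinM mulrC.
exists (~` U); split; first exact: measurableC.
  by rewrite probability_setC// PU subee.
by move=> w /= H [k _ Hk]; apply: H; exists k.
Qed.

Lemma poisson_laplace c : 0 <= c ->
  (\int[P]_w count_laplace c (Z w) = (expR (- (m * (1 - expR (- c)))))%:E)%E.
Proof.
move=> c0; rewrite integral_nneseries//; last first.
    move=> k; apply: measurable_funeM; apply/measurable_EFinP.
    have mI : measurable_fun setT (\1_[set (k%:R : R)%:E] : \bar R -> R).
      by apply: measurable_indic; exact: emeasurable_set1.
    exact: (measurableT_comp mI mZ).
rewrite (@eq_eseriesr _ _ (fun k => (expR (- m))%:E * ((m * expR (- c)) ^+ k / k`!%:R)%:E)%E).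
  rewrite nneseriesZl; last first.
    by move=> k _; rewrite lee_fin divr_ge0// exprn_ge0// mulr_ge0// expR_ge0.
  rewrite nneseries_expR ?mulr_ge0 ?expR_ge0// -EFinM -expRD; congr (expR _)%:E.
  ring.
move=> k _; rewrite ge0_integralZl ?lee_fin ?expR_ge0//; last first.
  apply/measurable_EFinP.
  have mI : measurable_fun setT (\1_[set (k%:R : R)%:E] : \bar R -> R).
    by apply: measurable_indic; exact: emeasurable_set1.
  exact: (measurableT_comp mI mZ).
have -> : (\int[P]_w (\1_[set (k%:R : R)%:E] (Z w))%:E = P [set w | Z w = k%:R%:E])%E.
  transitivity (\int[P]_w (\1_[set w | Z w = k%:R%:E] w)%:E)%E; last first.
    by rewrite integral_indic// setIT.
  by apply: eq_integral => w _; rewrite !indicE.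
rewrite PZ -!EFinM; congr EFin.
have -> : expR (- (c * k%:R)) = expR (- c) ^+ k by rewrite -mulNr mulrC -expRM_natl.
rewrite exprMn; ring.
Qed.

End poisson_laplace.

(** * Simple functions decomposed along their nonzero values *)

Section simple_functions.
Import HBNNSimple finmap.finmap.
Context {d : measure_display} {T : measurableType d} {R : realType}.
Variable f : {nnsfun T >-> R}.

(** The value 0 is discarded because its level set may have infinite intensity, whereas the others
    have finite intensity as soon as [f] is integrable. *)
Definition nonzero_values : seq R := [seq y <- fset_set (range (f : T -> R)) | y != 0].

Lemma uniq_nonzero_values : uniq nonzero_values.
Proof. by rewrite filter_uniq// fset_uniq. Qed.

Lemma nonzero_valuesE y : (y \in nonzero_values) = (y != 0) && (y \in range (f : T -> R)).
Proof. by rewrite mem_filter -(in_fset_set (fimfunP f)). Qed.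

Lemma nonzero_values_gt0 y : y \in nonzero_values -> 0 < y.
Proof.
by rewrite nonzero_valuesE lt0r => /andP[-> /set_mem[x _ <-]]; exact: fun_ge0.
Qed.

Lemma nnsfun_comp_sum (h : R -> R) x : h 0 = 0 ->
  h (f x) = \sum_(y <- nonzero_values) h y * \1_(f @^-1` [set y]) x.
Proof.
move=> h0; have us := uniq_nonzero_values.
have [fx0|fx0] := eqVneq (f x) 0.
  rewrite fx0 h0 big_seq big1// => y; rewrite nonzero_valuesE => /andP[y0 _].
  by rewrite indicE memNset ?mulr0//= fx0 => /esym/eqP; apply/negP.
rewrite (bigD1_seq (f x))//=; last first.
  by rewrite nonzero_valuesE fx0 mem_set//; exists x.
rewrite indicE mem_set// mulr1 big1 ?addr0// => y yfx.
by rewrite indicE memNset ?mulr0//= => /esym/eqP; apply/negP.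
Qed.

(** Stated for a function [h] vanishing at 0 so as to cover both exponents of the Poisson formula:
    [h y = y] and [h y = 1 - exp(- y)]. *)
Lemma integral_nnsfun_comp (mu : {measure set T -> \bar R}) (h : R -> R) :
  h 0 = 0 -> (forall y, 0 <= y -> 0 <= h y) ->
  (\int[mu]_x (h (f x))%:E =
   \sum_(y <- nonzero_values) (h y)%:E * mu (f @^-1` [set y]))%E.
Proof.
move=> h0 hge0.
under eq_integral => x _ do rewrite (nnsfun_comp_sum x h0) -sumEFin.
rewrite ge0_integral_sum//.
- rewrite big_seq [RHS]big_seq; apply: eq_bigr => y ys.
  under eq_integral do rewrite EFinM.
  rewrite ge0_integralZl ?lee_fin ?hge0 ?(ltW (nonzero_values_gt0 ys))//.
    by rewrite integral_indic// setIT.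
  by apply/measurable_EFinP; exact: measurable_indic.
- move=> y; apply/measurable_EFinP; apply: measurable_funM.
    exact: measurable_cst.
  exact: measurable_indic.
- move=> y x _; rewrite lee_fin indicE; case: (boolP (x \in _)) => [|_].
    by move=> /set_mem /= <-; rewrite mulr1 hge0// fun_ge0.
  by rewrite mulr0.
Qed.

End simple_functions.

Lemma expeR_oppe_sum (R : realType) (I : Type) (s : seq I) (F : I -> \bar R) :
  (forall i, 0 <= F i)%E ->
  expeR (- \sum_(i <- s) F i)%E = (\prod_(i <- s) expeR (- F i))%E.
Proof.
move=> F0; elim: s => [|i s IH]; first by rewrite !big_nil oppe0 expeR0.
rewrite !big_cons -IH -expeRD oppeD// ge0_adde_def ?inE ?sume_ge0//.
Qed.

Lemma measurable_expeR (R : realType) : measurable_fun setT (@expeR R).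
Proof.
rewrite (_ : @expeR R = fun x => if x == +oo%E then +oo%E else
    if x == -oo%E then 0%E else (expR (fine x))%:E); last first.
  by apply/funext => -[].
apply: measurable_fun_ifT => //; first exact: measurable_fun_eqe.
apply: measurable_fun_ifT => //; first exact: measurable_fun_eqe.
apply/measurable_EFinP; apply: (measurableT_comp (@measurable_expR R)).
done.
Qed.

(** An infinite limit has to be allowed, with [exp(- oo) = 0]: [exp(- u n) <= e] as soon as
    [u n >= - ln e]. *)
Lemma cvg_expeR_oppe (R : realType) (u : nat -> \bar R) (l : \bar R) :
  (forall n, 0 <= u n)%E -> (0 <= l)%E -> u n @[n --> \oo] --> l ->
  expeR (- u n)%E @[n --> \oo] --> expeR (- l)%E.
Proof.
move=> u0; case: l => [l| |//] l0.
  move=> /fine_cvgP[ufin ul]; rewrite /=.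
  have H : (expR (- fine (u n)))%:E @[n --> \oo] --> (expR (- l))%:E.
    apply: cvg_EFin; first by near=> n.
    apply: (@cvg_comp _ _ _ (fun n => - fine (u n)) expR); last exact: continuous_expR.
    exact: cvgN.
  apply: cvg_trans H; apply: near_eq_cvg; near=> n.
  have : u n \is a fin_num by near: n.
  by case: (u n).
move=> /cvgeyPge uoo; apply/fine_cvgP; split.
  near=> n; rewrite ge0_fin_numE ?expeR_ge0//.
  apply: (@le_lt_trans _ _ 1%E); last exact: ltry.
  by rewrite -expeR0 lee_expeR oppe_le0.
rewrite /=; apply/cvgrPdist_le => e e0; near=> n.
have un : ((- ln e)%:E <= u n)%E by near: n.
have : (expeR (- u n) <= e%:E)%E.
  rewrite -[e](@lnK _ e) ?posrE// -[(expR _)%:E]/(expeR (ln e)%:E) lee_expeR.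
  by rewrite leeNl.
rewrite sub0r normrN ger0_norm ?fine_ge0 ?expeR_ge0//.
have := expeR_ge0 (- u n)%E.
rewrite /=; case: (expeR _) => [r _|_ _|//]; first by rewrite lee_fin.
exact: ltW.
Unshelve. all: by end_near. Qed.

Section Mp_ge0_integral.
Import HBNNSimple.

Lemma measurable_Mp_ge0_integral (R : realType) (p : R) (f : plane R -> R) :
  measurable_fun setT (EFin \o f) -> (forall x, 0 <= f x) ->
  measurable_fun setT (fun nu : Mp p => \int[nu]_x (f x)%:E)%E.
Proof.
move=> mf f0; pose g := nnsfun_approx measurableT mf.
have gf x : (g n x)%:E @[n --> \oo] --> (f x)%:E.
  by apply: (@cvg_nnsfun_approx _ _ _ _ measurableT _ mf) => // y _; rewrite lee_fin.
apply: (emeasurable_fun_cvg (fun n (nu : Mp p) => \int[nu]_x (g n x)%:E)%E) => [n|nu _].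
  under eq_fun do rewrite (integral_nnsfun_comp (g n) _ (h := id))//.
  apply: emeasurable_sum => i; apply: measurable_funeM.
  have mgi : measurable (g n @^-1` [set i]) by exact: measurable_sfunP.
  exact: measurable_Mp_ev.
under [X in _ --> X]eq_integral => x _ do rewrite -(cvg_lim _ (gf x))//.
apply: cvg_monotone_convergence => //.
- by move=> n; exact/measurable_EFinP.
- by move=> n x _; rewrite lee_fin.
- by move=> x _ m n mn; rewrite lee_fin; exact/lefP/nd_nnsfun_approx.
Qed.

End Mp_ge0_integral.

(** * Laplace functional of a Poisson random measure *)

Section poisson_random_measure_laplace.
Context {R : realType} {p : R} {d : measure_display} {Omega : measurableType d}.
Variable P : probability Omega R.
Variable Lambda : {measure set (plane R) -> \bar R}.
Variable N : Omega -> Mp p.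
Hypothesis mN : measurable_fun setT N.
Hypothesis prm : poisson_random_measure P Lambda N.
Import HBNNSimple.

Lemma measurable_laplace (f : plane R -> R) :
  measurable_fun setT (EFin \o f) -> (forall x, 0 <= f x) ->
  measurable_fun setT (fun w => expeR (- \int[N w]_x (f x)%:E))%E.
Proof.
move=> mf f0; apply: (measurableT_comp (@measurable_expeR R)).
apply: measurableT_comp => //.
exact: (measurableT_comp (measurable_Mp_ge0_integral mf f0) mN).
Qed.

(** The integral of [f] is a combination of the counts on the level sets of [f]; these are disjoint,
    so the counts are independent Poisson variables and the Laplace transforms multiply. *)
Lemma laplace_prm_simple (f : {nnsfun (plane R) >-> R}) :
  (\int[Lambda]_x (f x)%:E < +oo)%E ->
  (\int[P]_w expeR (- \int[N w]_x (f x)%:E) =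
   expeR (- \int[Lambda]_x (1 - expR (- f x))%:E))%E.
Proof.
move=> ffin; have [prm1 _ prm3] := prm.
set s := nonzero_values f.
pose n := size s.
pose c (i : 'I_n) := s`_i.
have cs i : c i \in s by exact: mem_nth.
have c0 i : 0 < c i by exact: nonzero_values_gt0 (cs i).
pose B (i : 'I_n) : set (plane R) := f @^-1` [set c i].
have mB i : measurable (B i) by exact: measurable_sfunP.
have intE (mu : {measure set (plane R) -> \bar R}) (h : R -> R) : h 0 = 0 -> (forall y, 0 <= y -> 0 <= h y) ->
    (\int[mu]_x (h (f x))%:E = \sum_(i < n) (h (c i))%:E * mu (B i))%E.
  by move=> h0 hge0; rewrite integral_nnsfun_comp// (big_nth 0) big_mkord.
(* A level set of infinite intensity with value [c i > 0] would make the integral of [f]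
   infinite. *)
have Lfin i : Lambda (B i) \is a fin_num.
  rewrite ge0_fin_numE//; move: ffin; rewrite (intE _ id)// => ffin.
  rewrite ltey; apply/eqP => Loo.
  have S0 : (0 <= \sum_(j < n | j != i) (c j)%:E * Lambda (B j))%E.
    by apply: sume_ge0 => j _; rewrite mule_ge0// lee_fin ltW.
  move: ffin; rewrite (bigD1 i)//= Loo gt0_muley ?lte_fin//.
  by case: (\sum_(j < n | _) _)%E S0.
pose m i := fine (Lambda (B i)).
have mE i : Lambda (B i) = (m i)%:E by rewrite fineK.
have m0 i : 0 <= m i by exact: fine_ge0.
have mNB i : measurable_fun setT (fun w => N w (B i)).
  exact: (measurableT_comp (measurable_Mp_ev (mB i)) mN).
have tB : trivIset setT B.
  move=> i j _ _ [x [/= fi fj]]; apply/val_inj/eqP.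
  rewrite -(nth_uniq 0 (ltn_ord i) (ltn_ord j)); last exact: uniq_nonzero_values.
  by apply/eqP; exact: etrans (esym fi) fj.
have indep A : (forall i, measurable (A i)) ->
  P (\bigcap_i [set w | A i (N w (B i))]) = (\prod_(i < n) P [set w | A i (N w (B i))])%E.
  by move=> mA; exact: prm3.
have PZ i k := prm1 _ _ (mB i) (mE i) k.
have aeN : {ae P, forall w, forall i : 'I_n, exists k : nat, N w (B i) = k%:R%:E}.
  apply: filter_forall => i.
  exact: (poisson_integer (mNB i) (m0 i) (PZ i)).
have mS (i : 'I_n) (k : nat) : measurable [set (k%:R : R)%:E] by exact: emeasurable_set1.
have a0 (i : 'I_n) (k : nat) : 0 <= expR (- (c i * k%:R)) by exact: expR_ge0.
have E := expectation_prod_countable_step mNB indep a0 mS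
  (fun i x => count_laplace_le1 x (ltW (c0 i))).
transitivity (\int[P]_w \prod_(i < n) count_laplace (c i) (N w (B i)))%E.
  apply: ae_eq_integral => //.
    by apply: measurable_laplace => //; exact/measurable_EFinP.
    apply: emeasurable_prod => i.
    exact: (measurable_countable_step mNB (fun i k => expR_ge0 _) mS).
  apply: filterS aeN => w Hw _.
  rewrite (intE _ id)// expeR_oppe_sum; last by move=> i; rewrite mule_ge0// lee_fin ltW.
  apply: eq_bigr => i _; have [k ->] := Hw i.
  by rewrite count_laplace_nat.
rewrite [LHS]E.
transitivity (\prod_(i < n) (expR (- (m i * (1 - expR (- c i)))))%:E)%E.
  apply: eq_bigr => i _.
  exact: (poisson_laplace (mNB i) (m0 i) (PZ i) (ltW (c0 i))).
rewrite (intE _ (fun y => 1 - expR (- y))).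
- rewrite expeR_oppe_sum; last first.
    move=> i; rewrite mule_ge0// lee_fin subr_ge0 -expR0 ler_expR oppr_le0 ltW//.
  by apply: eq_bigr => i _; rewrite mE -EFinM mulrC.
- by rewrite oppr0 expR0 subrr.
- by move=> y y0; rewrite subr_ge0 -expR0 ler_expR oppr_le0.
Qed.

(** Simple functions increase to [f]. Both exponents converge monotonically, the expectation by
    boundedness; the approximations inherit the finite integral from [f]. *)
Lemma laplace_prm (f : plane R -> R) : measurable_fun setT (EFin \o f) ->
  (forall x, 0 <= f x) -> (\int[Lambda]_x (f x)%:E < +oo)%E ->
  (\int[P]_w expeR (- \int[N w]_x (f x)%:E) =
   expeR (- \int[Lambda]_x (1 - expR (- f x))%:E))%E.
Proof.
move=> mf f0 ffin.
pose g := nnsfun_approx measurableT mf.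
have gf x : (g n x)%:E @[n --> \oo] --> (f x)%:E.
  by apply: (@cvg_nnsfun_approx _ _ _ _ measurableT _ mf) => // y _; rewrite lee_fin.
have gf' x : g n x @[n --> \oo] --> f x by have /fine_cvgP[] := gf x.
have ndg x : {homo (fun n => g n x) : m n / (m <= n)%N >-> m <= n}.
  by move=> m n mn; exact/lefP/nd_nnsfun_approx.
have gle n x : g n x <= f x.
  have cg : cvgn (fun n => g n x) by apply: (cvgP (f x)); exact: gf'.
  by have := nondecreasing_cvgn_le (ndg x) cg n; rewrite (cvg_lim _ (gf' x)).
have mg n : measurable_fun setT (EFin \o g n) by exact/measurable_EFinP.
have intg (mu : {measure set (plane R) -> \bar R}) :
    (\int[mu]_x (g n x)%:E)%E @[n --> \oo] --> (\int[mu]_x (f x)%:E)%E.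
  under [X in _ --> X]eq_integral => x _ do rewrite -(cvg_lim _ (gf x))//.
  apply: cvg_monotone_convergence => //.
  - by move=> n x _; rewrite lee_fin.
  - by move=> x _ m n mn; rewrite lee_fin ndg.
have mh (h : plane R -> R) : measurable_fun setT (EFin \o h) ->
    measurable_fun setT (fun x => (1 - expR (- h x))%:E).
  move=> /measurable_EFinP h1; apply/measurable_EFinP; apply: measurable_funB => //.
  by apply: measurableT_comp => //; apply: measurableT_comp.
have h0 (y : R) : 0 <= y -> 0 <= 1 - expR (- y).
  by move=> y0; rewrite subr_ge0 -expR0 ler_expR oppr_le0.
have hg x : (1 - expR (- g n x))%:E @[n --> \oo] --> (1 - expR (- f x))%:E.
  apply: cvg_EFin; first by near=> n.
  apply: cvgB; first exact: cvg_cst.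
  apply: (@cvg_comp _ _ _ (fun n => - g n x) expR); last exact: continuous_expR.
  exact: cvgN.
have RHS1 : (\int[Lambda]_x (1 - expR (- g n x))%:E)%E @[n --> \oo] -->
    (\int[Lambda]_x (1 - expR (- f x))%:E)%E.
  under [X in _ --> X]eq_integral => x _ do rewrite -(cvg_lim _ (hg x))//.
  apply: cvg_monotone_convergence => //.
  - by move=> n; exact: mh.
  - by move=> n x _; rewrite lee_fin h0.
  - by move=> x _ m n mn; rewrite lee_fin lerD2l lerN2 ler_expR lerN2 ndg.
have RHS2 := cvg_expeR_oppe _ _ RHS1.
have LHS1 : (\int[P]_w expeR (- \int[N w]_x (g n x)%:E))%E @[n --> \oo] -->
    (\int[P]_w expeR (- \int[N w]_x (f x)%:E))%E.
  apply: bounded_convergence.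
  - exact: le_lt_trans (probability_le1 P measurableT) (ltry _).
  - by move=> n; apply: measurable_laplace => //; exact: mg.
  - move=> n w; rewrite expeR_ge0/= -expeR0 lee_expeR oppe_le0.
    by apply: integral_ge0 => x _; rewrite lee_fin.
  - move=> w; apply: cvg_expeR_oppe => //.
    + by move=> n; apply: integral_ge0 => x _; rewrite lee_fin.
    + by apply: integral_ge0 => x _; rewrite lee_fin.
have E n : (\int[P]_w expeR (- \int[N w]_x (g n x)%:E) =
   expeR (- \int[Lambda]_x (1 - expR (- g n x))%:E))%E.
  apply: laplace_prm_simple; apply: le_lt_trans ffin.
  apply: ge0_le_integral => //.
  - by move=> x _; rewrite lee_fin.
  - exact: mg.
  - by move=> x _; rewrite lee_fin.
apply: (cvg_unique _ LHS1) => //=; under eq_fun do rewrite E.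
apply: RHS2.
- by move=> n; apply: integral_ge0 => x _; rewrite lee_fin h0.
- by apply: integral_ge0 => x _; rewrite lee_fin h0.
Unshelve. all: by end_near. Qed.

End poisson_random_measure_laplace.

(** * The limiting exponent and its two-sided bounds *)

Section hole_exponent.
Context {R : realType} {p : R}.
Variable Q : R -> R.-pker (Mp p) ~> (Mp p).
Hypothesis hQ : sbm_transition Q.
Hypothesis p0 : 0 < p.
Implicit Types (r e L : R) (x : R * R).

(** Heuristically the solution at time 1 with datum infinite on the open disc and 0 elsewhere. The
    limit exists since the sequence increases and is bounded by 1. *)
Definition cone_limit r x : R := limn (fun n => cone_solution r n%:R 1 x).

Lemma cone_solution_nondecreasing r x :
  {homo (fun n => cone_solution r n%:R 1 x) : m n / (m <= n)%N >-> m <= n}.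
Proof. by move=> m n mn; apply: (cone_solution_le hQ p0) => //; rewrite ler_nat. Qed.

Lemma is_cvg_cone_solution r x : cvgn (fun n => cone_solution r n%:R 1 x).
Proof.
apply: nondecreasing_is_cvgn; first exact: cone_solution_nondecreasing.
by exists 1 => _ [n _ <-]; exact: (cone_solution_le1 hQ p0).
Qed.

Lemma cvg_cone_solution r x :
  cone_solution r n%:R 1 x @[n --> \oo] --> cone_limit r x.
Proof. exact: is_cvg_cone_solution. Qed.

Lemma cone_solution_le_limit r n x : cone_solution r n%:R 1 x <= cone_limit r x.
Proof.
apply: (nondecreasing_cvgn_le (@cone_solution_nondecreasing r x)).
exact: is_cvg_cone_solution.
Qed.

Lemma cone_limit_le r x (M : R) :
  (forall n, cone_solution r n%:R 1 x <= M) -> cone_limit r x <= M.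
Proof.
move=> H; apply: limr_le; first exact: is_cvg_cone_solution.
by near=> n.
Unshelve. all: by end_near. Qed.

Lemma cone_limit_le1 r x : cone_limit r x <= 1.
Proof. by apply: cone_limit_le => n; exact: (cone_solution_le1 hQ p0). Qed.

Lemma cone_limit_ge0 r x : 0 <= cone_limit r x.
Proof.
apply: le_trans (cone_solution_le_limit r 0 x).
exact: (cone_solution_ge0 hQ p0).
Qed.

(** As the slope tends to infinity, the logistic factor in [cone_solution_lower] tends to 1 and only
    the exponential loss remains. *)
Lemma cone_limit_lower r L x : 0 < L -> enorm x < r - L ->
  expR (- (4 / L ^+ 2)) <= cone_limit r x.
Proof.
move=> L0 xr; set m := r - L - enorm x.
have m0 : 0 < m by rewrite subr_gt0.
have H : expR (- (4 / L ^+ 2)) * (n%:R * m / (1 + n%:R * m)) @[n --> \oo] -->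
    expR (- (4 / L ^+ 2)) * 1.
  apply: cvgM; first exact: cvg_cst.
  have -> : (fun n : nat => n%:R * m / (1 + n%:R * m)) =
      (fun n : nat => 1 - (1 + n%:R * m)^-1).
    apply/funext => n; have : 1 + n%:R * m != 0.
      by rewrite gt_eqF// ltr_pwDl// mulr_ge0// ltW.
    by move=> ?; field.
  rewrite -[X in _ --> X]subr0; apply: cvgB; first exact: cvg_cst.
  apply/gtr0_cvgV0; first by near=> n; rewrite ltr_pwDl// mulr_ge0// ltW.
  apply/cvgryPge => A; have /cvgryPge/(_ (A / m)) := @cvgr_idn R.
  by apply: filterS => n; rewrite ler_pdivrMr// => /le_trans; apply; rewrite lerDr.
rewrite mulr1 in H; apply: (ler_cvg_to H (@cvg_cone_solution r x)).
near=> n; exact: (cone_solution_lower hQ p0).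
Unshelve. all: by end_near. Qed.

Lemma measurable_cone_solution r k t : 0 <= k -> 0 <= t ->
  measurable_fun setT (fun x : plane R => (cone_solution r k t x)%:E).
Proof.
by move=> k0 t0; apply: (solution_measurable hQ) => //; exact: cone_admissible.
Qed.

Lemma measurable_cone_limit r :
  measurable_fun setT (fun x : plane R => (cone_limit r x)%:E).
Proof.
apply: (emeasurable_fun_cvg (fun n x => (cone_solution r n%:R 1 x)%:E)).
  by move=> n; exact: measurable_cone_solution.
move=> x _; apply: cvg_EFin; first by near=> n.
exact: cvg_cone_solution.
Unshelve. all: by end_near. Qed.

(** It involves the equation only, so processes with different kernels share the same exponent. *)
Definition hole_exponent r : \bar R := (\int[leb2]_x (cone_limit r x)%:E)%E.

Lemma cvg_hole_exponent r :
  (\int[leb2]_x (cone_solution r n%:R 1 x)%:E)%E @[n --> \oo] --> hole_exponent r.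
Proof.
rewrite /hole_exponent.
have H x : (cone_solution r n%:R 1 x)%:E @[n --> \oo] --> (cone_limit r x)%:E.
  apply: cvg_EFin; first by near=> n.
  exact: cvg_cone_solution.
under [X in _ --> X]eq_integral => x _ do rewrite -(cvg_lim _ (H x))//.
apply: cvg_monotone_convergence.
- exact: measurableT.
- by move=> n; exact: measurable_cone_solution.
- by move=> n x _; rewrite lee_fin; exact: (cone_solution_ge0 hQ p0).
- by move=> x _ m n mn; rewrite lee_fin; exact: cone_solution_nondecreasing.
Unshelve. all: by end_near. Qed.

Lemma hole_exponent_lower r L : 0 < L -> L < r ->
  ((expR (- (4 / L ^+ 2)) * (pi * (r - L) ^+ 2))%:E <= hole_exponent r)%E.
Proof.
move=> L0 Lr; have rL0 : 0 < r - L by rewrite subr_gt0.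
have mD := @measurable_disc R (r - L).
rewrite EFinM -leb2_disc//.
rewrite -[disc (r - L)]setIT -(integral_indic leb2 measurableT mD).
rewrite -ge0_integralZl; last 4 first.
- exact: measurableT.
- by apply/measurable_EFinP; exact: measurable_indic.
- by move=> x _; rewrite lee_fin.
- by rewrite lee_fin expR_ge0.
apply: ge0_le_integral.
- exact: measurableT.
- by move=> x _; rewrite mule_ge0// lee_fin expR_ge0.
- apply: measurable_funeM; apply/measurable_EFinP; exact: measurable_indic.
- exact: measurable_cone_limit.
move=> x _; rewrite -EFinM lee_fin indicE; case: (boolP (x \in _)) => [|_].
  by move=> /set_mem xr; rewrite mulr1; exact: cone_limit_lower.
by rewrite mulr0 cone_limit_ge0.
Qed.

(** The bound 1 is integrated over the disc of radius [(1 + e) r], and the tail bound, through its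
    product majorant, over the plane. *)
Lemma hole_exponent_upper r e : 0 < r -> 0 < e ->
  (hole_exponent r <= (pi * ((1 + e) * r) ^+ 2 + 800 * ((1 + e) / e) ^+ 4 *
    (1 + (((1 + e) * r) ^+ 2)^-1) ^+ 2 * pi ^+ 2)%:E)%E.
Proof.
move=> r0 e0; have er : 0 < (1 + e) * r by apply: mulr_gt0 => //; lra.
set C := 800 * _ * _.
have C0 : 0 <= C.
  rewrite /C; have : 0 <= 800 :> R by rewrite ler0n.
  move: (800 : R) => M M0; rewrite mulr_ge0 ?sqr_ge0// mulr_ge0// exprn_ge0//.
  by rewrite divr_ge0// ltW//; lra.
have mD := @measurable_disc R ((1 + e) * r).
have mC := @measurable_indic _ (plane R) R setT _ mD.
have mO : measurable_fun setT (fun x : plane R => (oneDsqr_inv2 x)%:E).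
  by apply/measurable_EFinP; apply: continuous_measurable_plane; exact: continuous_oneDsqr_inv2.
rewrite EFinD -leb2_disc// EFinM -integral_oneDsqr_inv2.
rewrite -[disc _]setIT -(integral_indic leb2 measurableT mD).
rewrite -ge0_integralZl; last 4 first.
- exact: measurableT.
- exact: mO.
- by move=> x _; rewrite lee_fin oneDsqr_inv2_ge0.
- by rewrite lee_fin.
rewrite -ge0_integralD; last 5 first.
- exact: measurableT.
- by move=> x _; rewrite lee_fin.
- exact/measurable_EFinP.
- by move=> x _; rewrite mule_ge0// lee_fin ?oneDsqr_inv2_ge0.
- exact: measurable_funeM.
apply: ge0_le_integral.
- exact: measurableT.
- by move=> x _; rewrite lee_fin cone_limit_ge0.
- exact: measurable_cone_limit.
- by apply: emeasurable_funD; [exact/measurable_EFinP|exact: measurable_funeM].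
move=> x _; rewrite -EFinM -EFinD lee_fin indicE.
have CO : 0 <= C * oneDsqr_inv2 x by rewrite mulr_ge0// oneDsqr_inv2_ge0.
case: (boolP (x \in _)) => [_|/negP xr].
  by rewrite (le_trans (cone_limit_le1 _ _))// lerDl.
rewrite add0r; apply: cone_limit_le => n; apply: (cone_solution_tail hQ p0) => //.
by rewrite leNgt; apply/negP => H; apply: xr; rewrite inE.
Qed.

Lemma hole_exponent_fin r : 0 < r -> hole_exponent r \is a fin_num.
Proof.
move=> r0; rewrite ge0_fin_numE; last first.
  by apply: integral_ge0 => x _; rewrite lee_fin cone_limit_ge0.
by apply: le_lt_trans (hole_exponent_upper r0 ltr01) (ltry _).
Qed.

Lemma hole_exponent_gt0 r : 0 < r -> (0 < hole_exponent r)%E.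
Proof.
move=> r0; have r2 : 0 < r / 2 by rewrite divr_gt0.
apply: lt_le_trans (hole_exponent_lower r2 _); last by lra.
rewrite lte_fin mulr_gt0 ?expR_gt0// mulr_gt0 ?pi_gt0// exprn_gt0//; lra.
Qed.

End hole_exponent.

(** * Probability of an empty disc from Lebesgue and from Poisson initial measures *)

Section null_disc_probability.
Context {R : realType} {p : R}.
Variable Q : R -> R.-pker (Mp p) ~> (Mp p).
Hypothesis hQ : sbm_transition Q.
Hypothesis p0 : 0 < p.
Implicit Types (r t : R).

Lemma hole_exponent_ge0 r : (0 <= hole_exponent r)%E.
Proof. by apply: integral_ge0 => x _; rewrite lee_fin; exact: (cone_limit_ge0 hQ p0). Qed.

(** The initial state is a point of [Mp p] that agrees with Lebesgue measure on Borel sets, which is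
    all that integrals see. *)
Lemma transition_null_disc_lebesgue (mu : Mp p) r :
  (forall B, measurable B -> mu B = leb2 B) ->
  Q 1 mu (null_disc r) = expeR (- hole_exponent r).
Proof.
move=> muE.
have H := transition_null_disc hQ p0 (v := r) (mu := mu) ltr01 ler01.
apply: (cvg_unique _ H) => //=.
apply: cvg_expeR_oppe.
- move=> n; apply: integral_ge0 => x _; rewrite lee_fin mulr1.
  exact: (cone_solution_ge0 hQ p0).
- exact: hole_exponent_ge0.
have E n : (\int[mu]_x (cone_solution r (n%:R * 1) 1 x)%:E =
    \int[leb2]_x (cone_solution r n%:R 1 x)%:E)%E.
  by rewrite mulr1; apply: eq_measure_integral => A mA _; exact: muE.
under eq_fun do rewrite E.
exact: (cvg_hole_exponent hQ p0).
Qed.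

(** With [s = v / t], [exp y >= 1 + y] used twice gives [s / (1 + s) <= 1 - exp(- s) <= s]; here
    [v <= 1] bounds [s] by [1 / t], uniformly in [v]. *)
Lemma expR_oppr_bounds (v t : R) : 0 < t -> 0 <= v <= 1 ->
  (1 + t^-1)^-1 * v <= t * (1 - expR (- (t^-1 * v))) <= v.
Proof.
move=> t0 /andP[v0 v1]; set s := t^-1 * v.
have ti0 : 0 < t^-1 by rewrite invr_gt0.
have s0 : 0 <= s by rewrite mulr_ge0// ltW.
have ts : t * s = v by rewrite mulVKf// gt_eqF.
apply/andP; split; last first.
  by rewrite -[leRHS]ts ler_wpM2l ?(ltW t0)//; have := expR_ge1Dx (- s); lra.
have H : expR (- s) <= (1 + s)^-1.
  by rewrite expRN lef_pV2 ?posrE ?expR_gt0 ?ltr_pwDl// expR_ge1Dx.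
have H2 : s * (1 + s)^-1 <= 1 - expR (- s).
  have -> : s * (1 + s)^-1 = 1 - (1 + s)^-1 by field; rewrite gt_eqF// ltr_pwDl.
  by rewrite lerD2l lerN2.
apply: (@le_trans _ _ (t * (s * (1 + s)^-1))); last by rewrite ler_wpM2l// ltW.
rewrite mulrA ts mulrC ler_wpM2l// lef_pV2 ?posrE ?ltr_pwDl ?(ltW ti0)//.
by rewrite lerD2l /s ler_piMr// ltW.
Qed.

Context {d : measure_display} {Omega : measurableType d}.
Variable P : probability Omega R.
Variable N : Omega -> Mp p.
Hypothesis mN : measurable_fun setT N.
Hypothesis prm : poisson_random_measure P leb2 N.

Lemma prm_null_disc_bounds r t : 0 < r -> 0 < t ->
  (expeR (- hole_exponent r) <=
     \int[P]_w Q t (N w) (null_disc (r * Num.sqrt t)) <=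
   expeR (- (((1 + t^-1)^-1)%:E * hole_exponent r)))%E.
Proof.
move=> r0 t0; set c := Num.sqrt t.
have c0 : 0 < c by rewrite sqrtr_gt0.
have ct : c ^+ 2 = t by rewrite sqr_sqrtr// ltW.
have c30 : 0 < (c ^+ 3)^-1 by rewrite invr_gt0 exprn_gt0.
(* The slopes are multiples of [t^(-3/2)] so that after rescaling [v n] has slope exactly [n], as in
   [cone_limit]. *)
pose f n x := cone_solution (r * c) (n%:R * (c ^+ 3)^-1) t x.
pose v n x := cone_solution r n%:R 1 x.
have k0 n : 0 <= n%:R * (c ^+ 3)^-1 by rewrite mulr_ge0// ltW.
have fv n x : f n (c *: x) = t^-1 * v n x.
  rewrite /f /v (cone_solution_scale hQ p0)//; congr (_ * cone_solution _ _ _ _).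
  by rewrite mulfVK// gt_eqF// exprn_gt0.
have t0' := ltW t0.
have f0 n x : 0 <= f n x by exact: (cone_solution_ge0 hQ p0).
have v01 n x : 0 <= v n x <= 1.
  by rewrite (cone_solution_ge0 hQ p0)// (cone_solution_le1 hQ p0).
have v0 n x : 0 <= v n x by have /andP[] := v01 n x.
have cf n : continuous (f n).
  by apply: (solution_continuous hQ) => //; exact: cone_admissible.
have cv n : continuous (v n).
  by apply: (solution_continuous hQ) => //; exact: cone_admissible.
have mf n : measurable_fun setT (fun x : plane R => (f n x)%:E).
  by apply/measurable_EFinP; exact: continuous_measurable_plane.
have mv n : measurable_fun setT (fun x : plane R => (v n x)%:E).
  by apply/measurable_EFinP; exact: continuous_measurable_plane.
have ce (g : R * R -> R) : continuous g -> continuous (fun x => 1 - expR (- g x)).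
  move=> cg x; apply: cvgB; first exact: cvg_cst.
  apply: (@cvg_comp _ _ _ (fun x => - g x) expR); last exact: continuous_expR.
  by apply: cvgN; exact: cg.
have intf n : (\int[leb2]_x (f n x)%:E = \int[leb2]_x (v n x)%:E)%E.
  rewrite (leb2_integral_scale c0 (cf n) (f0 n)); apply: eq_integral => x _.
  by rewrite fv ct mulVKf// gt_eqF.
have vle n : (\int[leb2]_x (v n x)%:E <= hole_exponent r)%E.
  apply: ge0_le_integral.
  - exact: measurableT.
  - by move=> x _; rewrite lee_fin.
  - exact: mv.
  - exact: (measurable_cone_limit hQ p0).
  - by move=> x _; rewrite lee_fin; exact: (cone_solution_le_limit hQ p0).
have Afin := hole_exponent_fin hQ p0 r0.
have intf_fin n : (\int[leb2]_x (f n x)%:E < +oo)%E.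
  by rewrite intf (le_lt_trans (vle n))// -ge0_fin_numE// hole_exponent_ge0.
pose b n := (\int[leb2]_x (1 - expR (- f n x))%:E)%E.
have e0 (y : R) : 0 <= y -> 0 <= 1 - expR (- y).
  by move=> y0; rewrite subr_ge0 -expR0 ler_expR oppr_le0.
have bE n : (b n = \int[leb2]_x (t * (1 - expR (- (t^-1 * v n x))))%:E)%E.
  rewrite /b (leb2_integral_scale c0 (ce _ (cf n))); last by move=> x; exact: e0.
  by apply: eq_integral => x _; rewrite fv ct.
have mb n : measurable_fun setT (fun x : plane R => (t * (1 - expR (- (t^-1 * v n x))))%:E).
  apply/measurable_EFinP; apply: continuous_measurable_plane => x.
  apply: cvgM; first exact: cvg_cst.
  apply: (ce (fun x => t^-1 * v n x)) => y.
  by apply: cvgM; [exact: cvg_cst|exact: cv].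
have b_le n : (b n <= hole_exponent r)%E.
  apply: le_trans (vle n); rewrite bE; apply: ge0_le_integral.
  - exact: measurableT.
  - by move=> x _; rewrite lee_fin mulr_ge0// e0// mulr_ge0// invr_ge0.
  - exact: mb.
  - exact: mv.
  - by move=> x _; rewrite lee_fin; have /andP[] := expR_oppr_bounds t0 (v01 n x).
have b_ge n : (((1 + t^-1)^-1)%:E * \int[leb2]_x (v n x)%:E <= b n)%E.
  have s0 : 0 <= (1 + t^-1)^-1 by rewrite invr_ge0 addr_ge0// invr_ge0.
  rewrite bE -ge0_integralZl; last 4 first.
  - exact: measurableT.
  - exact: mv.
  - by move=> x _; rewrite lee_fin.
  - by rewrite lee_fin.
  apply: ge0_le_integral.
  - exact: measurableT.
  - by move=> x _; rewrite mule_ge0// lee_fin.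
  - exact: measurable_funeM.
  - exact: mb.
  - by move=> x _; rewrite -EFinM lee_fin; have /andP[] := expR_oppr_bounds t0 (v01 n x).
have lim : expeR (- b n)%E @[n --> \oo] -->
    (\int[P]_w Q t (N w) (null_disc (r * c)))%E.
  have -> : (fun n => expeR (- b n)%E) =
      (fun n => \int[P]_w expeR (- \int[N w]_x (f n x)%:E))%E.
    by apply/funext => n; rewrite (laplace_prm mN prm (mf n) (f0 n) (intf_fin n)).
  apply: bounded_convergence.
  - exact: le_lt_trans (probability_le1 P measurableT) (ltry _).
  - by move=> n; exact: (measurable_laplace mN (mf n) (f0 n)).
  - move=> n w; rewrite expeR_ge0/= -expeR0 lee_expeR oppe_le0.
    by apply: integral_ge0 => x _; rewrite lee_fin.
  - by move=> w; exact: (transition_null_disc hQ p0).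
apply/andP; split.
  apply: (cvge_to_ge lim); near=> n.
  by rewrite lee_expeR leeN2.
apply: (lee_cvg_to lim).
  apply: (@cvg_expeR_oppe _ (fun n => ((1 + t^-1)^-1)%:E * \int[leb2]_x (v n x)%:E)%E).
  - move=> n; rewrite mule_ge0// ?lee_fin ?invr_ge0 ?addr_ge0 ?invr_ge0//.
    by apply: integral_ge0 => x _; rewrite lee_fin.
  - by rewrite mule_ge0 ?hole_exponent_ge0// lee_fin invr_ge0 addr_ge0// invr_ge0.
  - by apply: cvgeZl => //; exact: (cvg_hole_exponent hQ p0).
by near=> n; rewrite lee_expeR leeN2.
Unshelve. all: by end_near. Qed.

End null_disc_probability.

(** The radius may be infinite, when the measure charges no disc; then both sides hold. *)
Lemma hole_radius_ge_div (R : realType) (p : R) (nu : Mp p) (r s : R) :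
  0 < r -> 0 < s ->
  (r%:E <= hole_radius nu * (s^-1)%:E)%E <-> null_disc (r * s) nu.
Proof.
move=> r0 s0; apply: iff_trans (hole_radius_ge nu (mulr_gt0 r0 s0)).
suff -> : (r%:E <= hole_radius nu * (s^-1)%:E)%E = ((r * s)%:E <= hole_radius nu)%E by [].
case: (hole_radius nu) => [h| |].
- by rewrite -EFinM !lee_fin ler_pdivlMr.
- by rewrite gt0_mulye ?lte_fin ?invr_gt0// !leey.
- by rewrite gt0_mulNye ?lte_fin ?invr_gt0.
Qed.

(** * One-time laws from the Markov property *)

Section markov.
Context {R : realType} {p : R} {d : measure_display} {Omega : measurableType d}.
Variables (P : probability Omega R) (Q : R -> R.-pker (Mp p) ~> (Mp p)).
Variable X : R -> Omega -> Mp p.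
Hypothesis hX : markov_process P Q X.

(** The Markov property is used at time 0 with the sure event as history. *)
Lemma markov_probability t (A : set (Mp p)) : 0 <= t -> measurable A ->
  P (X t @^-1` A) = (\int[P]_w Q t (X 0 w) A)%E.
Proof.
move=> t0 mA; have [_ H] := hX.
have hT : history X 0 setT.
  rewrite -setC0 -setTD; apply: sigma_algebraCD; exact: sigma_algebra0.
by have := H 0 t setT A (lexx 0) t0 hT mA; rewrite setTI add0r.
Qed.

End markov.

(** * Growth of the exponent for large radius *)

Section asymptotics.
Context {R : realType} {p : R}.
Variable Q : R -> R.-pker (Mp p) ~> (Mp p).
Hypothesis hQ : sbm_transition Q.
Hypothesis p0 : 0 < p.

(* [hole_exponent_lower] at [L = z^-2] and [hole_exponent_upper] at [e = z]. *)
Lemma hole_exponent_ratio_bounds (z : R) : 0 < z < 1 ->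
  expR (- (4 * z ^+ 4)) * (1 - z ^+ 2) ^+ 2 <=
  fine (hole_exponent (z ^- 4)) / (pi * (z ^- 4) ^+ 2) <=
  (1 + z) ^+ 2 + 800 * 64 * pi * z ^+ 4.
Proof.
move=> /andP[z0 z1]; set r := z ^- 4.
have r0 : 0 < r by rewrite invr_gt0 exprn_gt0.
have pi0 := pi_gt0 R.
have pr0 : 0 < pi * r ^+ 2 by rewrite mulr_gt0// exprn_gt0.
have rz : r * z ^+ 4 = 1 by rewrite mulVf// gt_eqF// exprn_gt0.
have Afin := hole_exponent_fin hQ p0 r0.
apply/andP; split.
  have L0 : 0 < z ^- 2 by rewrite invr_gt0 exprn_gt0.
  have Lr : z ^- 2 < r.
    by rewrite ltf_pV2 ?posrE ?exprn_gt0// ltr_iXn2l.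
  rewrite ler_pdivlMr// -lee_fin fineK//.
  apply: le_trans (hole_exponent_lower hQ p0 L0 Lr).
  rewrite lee_fin le_eqVlt; apply/orP; left; apply/eqP.
  have -> : 4 / z ^- 2 ^+ 2 = 4 * z ^+ 4 by field; rewrite gt_eqF.
  rewrite -mulrA; congr (_ * _).
  rewrite /r; field; rewrite gt_eqF//.
rewrite ler_pdivrMr// -lee_fin fineK//.
apply: le_trans (hole_exponent_upper hQ p0 r0 z0) _.
rewrite lee_fin [leRHS]mulrDl exprMn.
have : 0 < 800 :> R by rewrite ltr0n.
move: (800 : R) => M M0.
rewrite (_ : pi * ((1 + z) ^+ 2 * r ^+ 2) = (1 + z) ^+ 2 * (pi * r ^+ 2)); last by ring.
rewrite lerD2l.
(* The constant 64 is [16 * 4]: [(1 + z)^4 <= 16], and the next factor is at most 4. Since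
   [z^-4 = r], the tail is of order [r], that is [z^4 r^2]. *)
have B1 : ((1 + z) / z) ^+ 4 <= 16 * r.
  rewrite exprMn exprVn ler_wpM2r ?(ltW r0)//.
  rewrite (_ : 16 = 2 ^+ 4); last by ring.
  rewrite ler_pXn2r ?nnegrE ?addr_ge0// ?ltW//; lra.
have r1 : 1 <= r by rewrite invf_ge1 ?exprn_gt0// exprn_ile1// ltW.
have B2 : (1 + ((1 + z) ^+ 2 * r ^+ 2)^-1) ^+ 2 <= 4.
  rewrite (_ : 4 = 2 ^+ 2); last by ring.
  have H : 1 <= (1 + z) ^+ 2 * r ^+ 2.
    by rewrite -exprMn exprn_ege1//; nra.
  have H2 : 0 < ((1 + z) ^+ 2 * r ^+ 2)^-1 by rewrite invr_gt0 (lt_le_trans _ H).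
  have H3 : ((1 + z) ^+ 2 * r ^+ 2)^-1 <= 1 by rewrite invf_le1// (lt_le_trans _ H).
  rewrite ler_pXn2r ?nnegrE//; lra.
have -> : M * 64 * pi * z ^+ 4 * (pi * r ^+ 2) = M * (16 * r) * 4 * pi ^+ 2.
  transitivity (M * 64 * pi ^+ 2 * r * (r * z ^+ 4)); first by ring.
  rewrite rz; ring.
rewrite ler_wpM2r ?sqr_ge0// ler_pM ?sqr_ge0//.
  by rewrite mulr_ge0 ?(ltW M0)// exprn_ge0// divr_ge0 ?addr_ge0// ltW.
by rewrite ler_wpM2l// ltW.
Qed.

Lemma cvg_hole_exponent_ratio :
  fine (hole_exponent r) / (pi * r ^+ 2) @[r --> +oo%R] --> (1 : R).
Proof.
(* [z = r^(-1/4)] balances the errors: [L = sqrt r] tends to infinity but is negligible against [r],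
   while [e = z] tends to 0 with [e^-4 = r] negligible against [r^2]. *)
pose z (r : R) := (Num.sqrt (Num.sqrt r))^-1.
have zr r : 0 < r -> z r ^- 4 = r.
  move=> r0; rewrite /z -exprVn invrK (exprM _ 2 2) !sqr_sqrtr ?sqrtr_ge0// ltW//.
have cz : z r @[r --> +oo%R] --> (0 : R).
  apply/gtr0_cvgV0.
    by near=> r; rewrite !sqrtr_gt0.
  apply/cvgryPge => A; near=> r.
  have A4 : (`|A| ^+ 2) ^+ 2 <= r by near: r; exact: nbhs_pinfty_ge.
  apply: le_trans (ler_norm A) _.
  have <- : Num.sqrt (Num.sqrt ((`|A| ^+ 2) ^+ 2)) = `|A|.
    by rewrite sqrtr_sqr ger0_norm ?sqr_ge0// sqrtr_sqr normr_id.
  by do 2 apply: ler_wsqrtr.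
have pol (f : R -> R) : {for 0, continuous f} -> f (z r) @[r --> +oo%R] --> f 0.
  by move=> cf; exact: (cvg_comp _ _ cz cf).
have cid (n : nat) : {for (0 : R), continuous (fun x : R => x ^+ n)}.
  exact: exprn_continuous.
apply: (@squeeze_cvgr _ _ _ _
  (fun r => expR (- (4 * z r ^+ 4)) * (1 - z r ^+ 2) ^+ 2)
  (fun r => (1 + z r) ^+ 2 + 800 * 64 * pi * z r ^+ 4)).
- near=> r.
  have r1 : 1 < r by near: r; exact: nbhs_pinfty_gt.
  have r0 : 0 < r by lra.
  have z01 : 0 < z r < 1.
    rewrite invr_gt0 !sqrtr_gt0 r0 /= invf_lt1 ?sqrtr_gt0 ?r0//.
    by rewrite -[ltLHS]sqrtr1 ltr_sqrt ?sqrtr_gt0// -[ltLHS]sqrtr1 ltr_sqrt.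
  by have := hole_exponent_ratio_bounds z01; rewrite zr.
- have := pol (fun z => expR (- (4 * z ^+ 4)) * (1 - z ^+ 2) ^+ 2) _.
  rewrite !expr0n !mulr0 !oppr0 expR0 addr0 expr1n mulr1; apply.
  apply: cvgM.
    apply: (@cvg_comp _ _ _ (fun z : R => - (4 * z ^+ 4)) expR); last exact: continuous_expR.
    by apply: cvgN; apply: cvgM; [exact: cvg_cst|exact: cid].
  apply: (@cvg_comp _ _ _ (fun z : R => 1 - z ^+ 2) (fun y => y ^+ 2)).
    by apply: cvgB; [exact: cvg_cst|exact: cid].
  exact: exprn_continuous.
- move: (800 * 64 * pi : R) => M.
  have := pol (fun z => (1 + z) ^+ 2 + M * z ^+ 4) _.
  rewrite expr0n /= mulr0 !addr0 expr1n; apply.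
  apply: cvgD; last by apply: cvgM; [exact: cvg_cst|exact: cid].
  apply: (@cvg_comp _ _ _ (fun z : R => 1 + z) (fun y => y ^+ 2)).
    by apply: cvgD; [exact: cvg_cst|exact: cvg_id].
  exact: exprn_continuous.
Unshelve. all: by end_near. Qed.

End asymptotics.

Theorem theorem1p2 (R : realType) (p : R) (hp : 2 < p)
    (d1 : measure_display) (Omega1 : measurableType d1)
    (P : probability Omega1 R) (X : R -> Omega1 -> Mp p)
    (hX : super_brownian_motion P X)
    (hX0 : poisson_random_measure P leb2 (X 0))
    (d2 : measure_display) (Omega2 : measurableType d2)
    (Plambda : probability Omega2 R) (Y : R -> Omega2 -> Mp p)
    (hY : super_brownian_motion Plambda Y)
    (hY0 : starts_from Plambda Y leb2) :
  (forall r : R, 0 < r ->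
    (P [set w | (r%:E <= hole_radius (X t w) * ((Num.sqrt t)^-1)%:E)%E]
       @[t --> +oo%R] --> (expR (- A2 Plambda Y r))%:E) /\
    0 < expR (- A2 Plambda Y r) < 1) /\
  (A2 Plambda Y r / (pi * r ^+ 2) @[r --> +oo%R] --> (1 : R)).
Proof.
have p0 : 0 < p by lra.
(* The two processes come with kernels of their own; [hole_exponent] is common to both. *)
have [Q [hQ mX]] := hX; have [Q' [hQ' mY]] := hY.
have mX0 : measurable_fun setT (X 0) by apply: mX.1.
pose a r := fine (hole_exponent r : \bar R).
have aE r : 0 < r -> hole_exponent r = (a r)%:E.
  by move=> r0; rewrite fineK// (hole_exponent_fin hQ p0).
(* The probability is [exp(- a r)] with [a r] finite, hence nonzero, so [ln] is a true inverse here
   and its value at 0 does not interfere. *)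
have A2E r : 0 < r -> A2 Plambda Y r = a r.
  move=> r0; rewrite /A2.
  have -> : Plambda [set w | Y 1 w (disc r) = 0%E] = (expR (- a r))%:E.
    rewrite -[[set w | _]]/(Y 1 @^-1` null_disc r).
    rewrite (markov_probability mY)//; last exact: measurable_null_disc.
    transitivity (\int[Plambda]_w (cst (expR (- a r))%:E w))%E.
      apply: ae_eq_integral => //.
        have mk := measurable_kernel (Q' 1) _ (measurable_null_disc r).
        exact: (measurableT_comp mk (mY.1 0 (lexx 0))).
      (* [Y 0] agrees with Lebesgue measure only almost surely, so the kernel is evaluated at
         [Y 0 w] for almost every [w]. *)
      apply: filterS hY0 => w Hw _.
      by rewrite (transition_null_disc_lebesgue hQ' p0 r Hw) aE.
    rewrite integral_cst// -[RHS]mule1; congr (_ * _)%E.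
    exact: probability_setT.
  by rewrite /= expRK opprK.
have PX r t : 0 < r -> 0 < t ->
  P [set w | (r%:E <= hole_radius (X t w) * ((Num.sqrt t)^-1)%:E)%E] =
  (\int[P]_w Q t (X 0%R w) (null_disc (r * Num.sqrt t)%R))%E.
  move=> r0 t0; rewrite -(markov_probability mX (ltW t0)); last exact: measurable_null_disc.
  congr (P _); apply/seteqP.
  by split => w /=; apply hole_radius_ge_div; rewrite ?sqrtr_gt0.
split; last first.
  apply: cvg_trans (cvg_hole_exponent_ratio hQ p0).
  by apply: near_eq_cvg; near=> r; rewrite A2E.
move=> r r0; rewrite A2E//; split; last first.
  rewrite expR_gt0 /= -expR0 ltr_expR oppr_lt0 -lte_fin -aE//.
  exact: (hole_exponent_gt0 hQ p0).
apply: (@squeeze_cvge _ _ _ _ (cst (expR (- a r))%:E) _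
  (fun t => (expR (- ((1 + t^-1)^-1 * a r)))%:E)).
- near=> t.
  have t0 : 0 < t by [].
  rewrite PX//; have := prm_null_disc_bounds hQ p0 mX0 hX0 r0 t0.
  by rewrite aE.
- exact: cvg_cst.
apply: cvg_EFin; first by near=> t.
rewrite -[X in _ --> expR (- X)]mul1r.
apply: (@cvg_comp _ _ _ (fun t => - ((1 + t^-1)^-1 * a r)) expR); last exact: continuous_expR.
apply: cvgN; apply: cvgM; last exact: cvg_cst.
rewrite -[X in _ --> X]invr1; apply: cvgV; first exact: oner_neq0.
rewrite -[X in _ --> X]addr0; apply: cvgD; first exact: cvg_cst.
by apply/gtr0_cvgV0; [near=> t|exact: cvg_id].
Unshelve. all: by end_near. Qed.
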